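(* Consider repeated robust risk minimization in each of the Models 1, 2, 3 described in the context. Suppose that: (A1) in Model 1, the loss function is $\gamma$-strongly convex in $\theta$ and $\beta$-smooth; (A2) in Model 2, $\bar A_j^\top\bar A_j\succ0$ for all $j\in[J]$, with $\alpha=2\min_{j\in[J]}\lambda_{\min}(\bar A_j^\top\bar A_j)$, and the feasible set $\Theta$ and the support of the reference distribution $\hat{\mathbb P}(\theta_t)$ are bounded; (A3) in Model 3, the loss function is $\gamma$-strongly convex in $\theta$ and $\beta$-smooth, and the support $\mathcal Z$ has finite diameter $D<\infty$. Suppose further that the distribution map $\hat{\mathbb P}(\cdot)$ is $\epsilon$-sensitive. Define $$\kappa=\frac{\beta}{\gamma+2\rho L}\ \text{(Model 1)},\qquad \kappa=\frac{Jdk_3\left(\frac{k_1k_2}{\mu}+1\right)}{\rho\alpha}\ \text{(Model 2)},\qquad \kappa=\frac{\beta+4D}{\min\{2\tau,\gamma\}}\ \text{(Model 3)},$$ where $k_1,k_2,k_3<\infty$ are model-dependent constants. Then, in each model: (a) $\|\theta_{t+1}-\theta_{t+1}'\|_2\le\epsilon\kappa\,\|\theta_t-\theta_t'\|_2$ for all $\theta_t,\theta_t'\in\Theta$, where $\theta_{t+1}$ and $\theta'_{t+1}$ are the next iterates produced from $\theta_t$ and $\theta_t'$ respectively. (b) If $\epsilon\kappa<1$, the iterates $\theta_t$ converge linearly to a unique performatively stable point $\theta_{\mathrm{RPS}}$ (denoted $\theta^\mu_{\mathrm{RPS}}$ in Model 2 and $\theta^\tau_{\mathrm{RPS}}$ in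 Model 3): for a predefined tolerance $\Delta>0$, $$\|\theta_t-\theta_{\mathrm{RPS}}\|_2\le\Delta\quad\text{for}\quad t\ge(1-\epsilon\kappa)^{-1}\log\big(\|\theta_0-\theta_{\mathrm{RPS}}\|_2/\Delta\big).$$
   Context: General setting. $\Theta\subseteq\mathbb R^d$ is the decision set, $\mathcal Z$ is the support set of the random parameter, and $\ell$ is the loss. Standing assumption: $\ell(z,\theta)$ is convex in $\theta$ for every fixed $z\in\mathcal Z$. $[n]=\{1,\dots,n\}$ and $\mathbb S^n$ is the space of real symmetric $n\times n$ matrices. The reference distribution map is $\hat{\mathbb P}(\theta)=\sum_{s=1}^S\hat p_s(\theta)\delta_{\hat z_s(\theta)}$ (finitely supported, $\hat p_s(\theta)\ge0$, $\sum_s\hat p_s(\theta)=1$). $\rho>0$ is the radius of the Wasserstein ambiguity set. Definitions. $\ell(z,\theta)$ is $\gamma$-strongly convex in $\theta$ if $\ell(z,\theta)\ge\ell(z,\theta')+\nabla_\theta\ell(z,\theta')^\top(\theta-\theta')+\frac\gamma2\|\theta-\theta'\|_2^2$ for all $\theta,\theta'\in\Theta$ and all $z\in\mathcal Z$ (convex if $\gamma=0$). It is $\beta$-smooth if $\|\nabla_\theta\ell(z,\theta)-\nabla_\theta\ell(z',\theta)\|_2\le\beta\|z-z'\|_2$ for all $z,z'\in\mathcal Z$ (and all $\theta\in\Theta$). The map $\hat{\mathbb P}(\cdot)$ is $\epsilon$-sensitive if $W_1(\hat{\mathbb P}(\theta),\hat{\mathbb P}(\theta'))\le\epsilon\|\theta-\theta'\|_2$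 for all $\theta,\theta'\in\Theta$, where $W_1$ is the 1-Wasserstein distance for the Euclidean norm $\|\cdot\|_2$ (Frobenius norm for matrix-valued parameters). Model 1. The random parameter is $Z=(Y,z,z^0)\in\mathbb S^d\times\mathbb R^d\times\mathbb R$, identified with $\begin{bmatrix}Y & z \\ z^\top & z^0\end{bmatrix}$; $\ell(Z,\theta)=\mathcal L(\theta^\top Y\theta+2z^\top\theta+z^0)$ with $\mathcal L:\mathbb R\to\mathbb R$ $L$-Lipschitz. The objective (the Tikhonov reformulation of the worst-case expected loss over the type-1 Wasserstein ball with Schatten-$\infty$ ground cost) is $\mathbb J_\eta(\theta)=\mathbb E_{\hat{\mathbb P}(\eta)}[\ell(\tilde Z,\theta)]+\rho L\|(\theta,1)\|_2^2$. Iteration: $\theta_{t+1}\in\arg\min_{\theta\in\Theta}\mathbb J_{\theta_t}(\theta)$. A stable point satisfies $\theta_{\mathrm{RPS}}\in\arg\min_{\theta\in\Theta}\mathbb J_{\theta_{\mathrm{RPS}}}(\theta)$. Model 2. The random parameter is $Z=(Y,z,z^0)\in\mathbb S^N\times\mathbb R^N\times\mathbb R$, identified with $\begin{bmatrix}Y & z \\ z^\top & z^0\end{bmatrix}\in\mathbb S^{N+1}$; $\ell(Z,\theta)=\max_{j\in[J]}Q_j(Z,\theta)$, $Q_j(Z,\theta)=a_j(\theta)^\top Ya_j(\theta)+2b_j(\theta)^\top z+c_j(\theta)z^0$, with affine $a_j(\theta)=\bar a_j+\bar A_j\theta$, $b_j(\theta)=\bar b_j+\bar B_j\theta$ in $\mathbb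 R^N$ and $c_j(\theta)=\bar c_{j0}+\bar c_j^\top\theta\in\mathbb R$. For smoothing parameter $\mu>0$ the smoothed objective (from the type-1 Wasserstein ball with Schatten-$\infty$ ground cost) is $$\mathbb J^\mu_\eta(\theta)=\mu\sum_{s\in[S]}\hat p_s(\eta)\log\Big(\sum_{j\in[J]}e^{Q_j(\hat Z_s(\eta),\theta)/\mu}\Big)+\mu\log\Big(\sum_{j\in[J]}e^{\rho(a_j(\theta)^\top a_j(\theta)+c_j(\theta))/\mu}\Big).$$ Iteration: $\theta_{t+1}\in\arg\min_{\theta\in\Theta}\mathbb J^\mu_{\theta_t}(\theta)$; the stable point satisfies $\theta^\mu_{\mathrm{RPS}}\in\arg\min_{\theta\in\Theta}\mathbb J^\mu_{\theta^\mu_{\mathrm{RPS}}}(\theta)$. With $\Gamma_j(\theta)=\begin{bmatrix}a_j(\theta)a_j(\theta)^\top & b_j(\theta) \\ b_j(\theta)^\top & c_j(\theta)\end{bmatrix}$, the finite model-dependent constants are bounds $k_1\ge\|Z\|_2$ for $Z$ in the supports of the reference distributions, $k_2\ge\|\Gamma_j(\theta)\|_2$ and $k_3\ge\|\nabla_{\theta_i}\Gamma_j(\theta)\|_2$ (entrywise partial derivative) for all $\theta\in\Theta$, $j\in[J]$, $i\in[d]$, with $\|\cdot\|_2$ the Frobenius norm. Model 3. $\mathcal Z\subseteq\mathbb R^m$ is nonempty, convex and closed, scenarios lie in $\mathcal Z$, and $\ell(\cdot,\theta)$ is proper, concave and upper semicontinuous for every $\theta$. For a constant $\tau>0$ the regularized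 objective (from the type-2 Wasserstein ball with Euclidean ground cost) is, for $(\theta,\lambda)\in\Theta\times\mathbb R_+$, $$\mathbb J^\tau_\eta(\theta,\lambda)=\sum_{s\in[S]}\hat p_s(\eta)\sup_{z\in\mathcal Z}\big(\ell(z,\theta)-\lambda\|z-\hat z_s(\eta)\|_2^2\big)+\rho^2\lambda+\tau\lambda^2 .$$ Iteration: $(\theta_{t+1},\lambda_{t+1})\in\arg\min_{(\theta,\lambda)\in\Theta\times\mathbb R_+}\mathbb J^\tau_{\theta_t}(\theta,\lambda)$; the stable point $\theta^\tau_{\mathrm{RPS}}$ is such that $(\theta^\tau_{\mathrm{RPS}},\lambda)\in\arg\min\mathbb J^\tau_{\theta^\tau_{\mathrm{RPS}}}$ over $\Theta\times\mathbb R_+$ for some $\lambda\ge0$. $D=\sup_{z,z'\in\mathcal Z}\|z-z'\|_2$.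
   Formalization: In Model 2 each piece Q_j(Z,θ), not only their maximum, is assumed convex in θ on Θ for Z in the support set; in all models Θ is assumed nonempty, closed and convex. Without these, minimizers may be non-unique or a stable point may not exist. *)

(* Defs.v *)
From HB Require Import structures.
From mathcomp Require Import all_boot all_order all_algebra.
From mathcomp Require Import all_classical all_reals all_analysis.

Set Implicit Arguments.
Unset Strict Implicit.
Unset Printing Implicit Defensive.

Import Order.TTheory GRing.Theory Num.Theory.
Import numFieldNormedType.Exports.

Local Open Scope classical_set_scope.
Local Open Scope ring_scope.

(* Vectors are columns. The canonical norm `|A| on matrices is the sup norm, so
   the Euclidean/Frobenius norm is defined here; both induce the same topology
   and the same bounded sets. *)
Definition frob {R : realType} {m n : nat} (A : 'M[R]_(m, n)) : R :=
  Num.sqrt (\sum_i \sum_j A i j ^+ 2).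

Definition pderiv {R : realType} {d : nat} (i : 'I_d) (f : 'cV[R]_d -> R)
  (theta : 'cV[R]_d) : R := 'D_(delta_mx i 0) f theta.

Definition grad {R : realType} {d : nat} (f : 'cV[R]_d -> R)
  (theta : 'cV[R]_d) : 'cV[R]_d := \col_i pderiv i f theta.

Definition argmin {R : realType} {X : Type} (A : set X) (f : X -> R) : set X :=
  [set x | A x /\ forall y, A y -> f x <= f y].

(* ** Finitely supported distributions and the 1-Wasserstein distance *)

(* \sum_s p_s \delta_{z_s}; atoms may repeat and weights may vanish. *)
Record refdist (R : realType) (S : nat) (T : Type) := RefDist {
  prob : 'I_S -> R ;
  atom : 'I_S -> T ;
  prob_ge0 : forall s, 0 <= prob s ;
  prob_sum1 : \sum_s prob s = 1 }.

Definition supp {R : realType} {S : nat} {T : Type} (P : refdist R S T) :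
  set T := [set atom P s | s in [set s | 0 < prob P s]].

(* Couplings are indexed by pairs of scenarios: every coupling of the two
   discrete measures arises from such a matrix, and conversely, with the same
   transport cost. *)
Definition coupling {R : realType} {S : nat} {T : Type}
    (P Q : refdist R S T) : set 'M[R]_S :=
  [set pi | [/\ forall s t, 0 <= pi s t,
                forall s, \sum_t pi s t = prob P s &
                forall t, \sum_s pi s t = prob Q t]].

Definition W1 {R : realType} {S m n : nat}
    (P Q : refdist R S 'M[R]_(m, n)) : R :=
  inf [set \sum_s \sum_t pi s t * frob (atom P s - atom Q t)
      | pi in coupling P Q].

Definition sensitive {R : realType} {d S m n : nat} (Theta : set 'cV[R]_d)
    (Phat : 'cV[R]_d -> refdist R S 'M[R]_(m, n)) (eps : R) : Prop :=
  forall theta theta', Theta theta -> Theta theta' ->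
    W1 (Phat theta) (Phat theta') <= eps * frob (theta - theta').

Definition supported_in {R : realType} {d S m n : nat} (Theta : set 'cV[R]_d)
    (Phat : 'cV[R]_d -> refdist R S 'M[R]_(m, n)) (Z : set 'M[R]_(m, n)) :
  Prop := forall theta, Theta theta -> supp (Phat theta) `<=` Z.

(* ** Assumptions on a loss l(z, theta) *)

Section LossAssumptions.
Context {R : realType} {d m n : nat}.
Variables (Theta : set 'cV[R]_d) (Z : set 'M[R]_(m, n)).
Variable loss : 'M[R]_(m, n) -> 'cV[R]_d -> R.

Definition convex_loss : Prop :=
  forall z, Z z -> convex_function Theta (loss z).

Definition differentiable_loss : Prop :=
  forall z theta, Z z -> Theta theta -> differentiable (loss z) theta.

Definition strongly_convex (gamma : R) : Prop :=
  forall z theta theta', Z z -> Theta theta -> Theta theta' ->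
    loss z theta' + ((grad (loss z) theta')^T *m (theta - theta')) 0 0
      + gamma / 2 * frob (theta - theta') ^+ 2 <= loss z theta.

Definition smooth (beta : R) : Prop :=
  forall z z' theta, Z z -> Z z' -> Theta theta ->
    frob (grad (loss z) theta - grad (loss z') theta) <= beta * frob (z - z').

End LossAssumptions.

(* ** Repeated risk minimization. [next theta] is the set of admissible next
   iterates (minimizers) produced from [theta]. *)

Section Repeated.
Context {R : realType} {d : nat}.
Variables (Theta : set 'cV[R]_d) (next : 'cV[R]_d -> set 'cV[R]_d).

Definition stable (theta : 'cV[R]_d) : Prop :=
  Theta theta /\ next theta theta.

Definition iterates (th : nat -> 'cV[R]_d) : Prop :=
  Theta (th 0) /\ forall t, next (th t) (th t.+1).

Definition step_lipschitz (k : R) : Prop :=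
  forall theta theta' u u', Theta theta -> Theta theta' ->
    next theta u -> next theta' u' ->
    frob (u - u') <= k * frob (theta - theta').

Definition linearly_convergent (th : nat -> 'cV[R]_d) (l : 'cV[R]_d) : Prop :=
  exists q : R, [/\ 0 <= q, q < 1 &
    forall t, frob (th t.+1 - l) <= q * frob (th t - l)].

(* If th 0 = ths then ln (0 / Delta) = 0 here (instead of -oo), so that the
   last clause covers every t in that case too. *)
Definition converges_to_unique_stable (k : R) : Prop :=
  exists ths : 'cV[R]_d,
    [/\ stable ths,
        forall theta, stable theta -> theta = ths &
        forall th, iterates th ->
          linearly_convergent th ths /\
          forall (Delta : R) (t : nat), 0 < Delta ->
            (1 - k)^-1 * ln (frob (th 0 - ths) / Delta) <= t%:R ->
            frob (th t - ths) <= Delta].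

End Repeated.

(* ** Quadratic parameters: the triple (Y, z, z0) is the symmetric block matrix
   Z = [Y z; z^T z0]. *)

Definition partY {R : realType} {n : nat} (Z : 'M[R]_(n + 1)) : 'M[R]_n :=
  ulsubmx Z.
Definition partz {R : realType} {n : nat} (Z : 'M[R]_(n + 1)) : 'cV[R]_n :=
  ursubmx Z.
Definition partz0 {R : realType} {n : nat} (Z : 'M[R]_(n + 1)) : R :=
  drsubmx Z 0 0.

(* *** Model 1 *)

Definition loss1 {R : realType} {d : nat} (Lfun : R -> R)
    (Z : 'M[R]_(d + 1)) (theta : 'cV[R]_d) : R :=
  Lfun ((theta^T *m partY Z *m theta) 0 0
        + 2 * ((partz Z)^T *m theta) 0 0 + partz0 Z).

Definition J1 {R : realType} {d S : nat} (Lfun : R -> R) (L rho : R)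
    (P : refdist R S 'M[R]_(d + 1)) (theta : 'cV[R]_d) : R :=
  \sum_s prob P s * loss1 Lfun (atom P s) theta
  + rho * L * frob (col_mx theta (const_mx 1 : 'cV[R]_1)) ^+ 2.

Definition next1 {R : realType} {d S : nat} (Theta : set 'cV[R]_d)
    (Lfun : R -> R) (L rho : R)
    (Phat : 'cV[R]_d -> refdist R S 'M[R]_(d + 1)) (eta : 'cV[R]_d) :
  set 'cV[R]_d := argmin Theta (J1 Lfun L rho (Phat eta)).

(* *** Model 2 *)

Record affine_pieces (R : realType) (J N d : nat) := AffinePieces {
  abar : 'I_J -> 'cV[R]_N ;
  Abar : 'I_J -> 'M[R]_(N, d) ;
  bbar : 'I_J -> 'cV[R]_N ;
  Bbar : 'I_J -> 'M[R]_(N, d) ;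
  c0bar : 'I_J -> R ;
  cbar : 'I_J -> 'cV[R]_d }.

Section Model2.
Context {R : realType} {J N d : nat}.
Variable M : affine_pieces R J N d.

Definition aj (j : 'I_J) (theta : 'cV[R]_d) : 'cV[R]_N :=
  abar M j + Abar M j *m theta.
Definition bj (j : 'I_J) (theta : 'cV[R]_d) : 'cV[R]_N :=
  bbar M j + Bbar M j *m theta.
Definition cj (j : 'I_J) (theta : 'cV[R]_d) : R :=
  c0bar M j + ((cbar M j)^T *m theta) 0 0.

Definition Qj (j : 'I_J) (Z : 'M[R]_(N + 1)) (theta : 'cV[R]_d) : R :=
  ((aj j theta)^T *m partY Z *m aj j theta) 0 0
  + 2 * ((bj j theta)^T *m partz Z) 0 0 + cj j theta * partz0 Z.

(* A supremum over finitely many pieces (at least one), i.e. max_j. Convexity of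
   loss2 does not pass to its log-sum-exp smoothing in J2 (take Q_1 = - theta^2,
   Q_2 = 0), convexity of every piece Qj does. *)
Definition loss2 (Z : 'M[R]_(N + 1)) (theta : 'cV[R]_d) : R :=
  sup (range (fun j => Qj j Z theta)).

Definition J2 {S : nat} (mu rho : R) (P : refdist R S 'M[R]_(N + 1))
    (theta : 'cV[R]_d) : R :=
  mu * (\sum_s prob P s * ln (\sum_j expR (Qj j (atom P s) theta / mu)))
  + mu * ln (\sum_j
      expR (rho * (((aj j theta)^T *m aj j theta) 0 0 + cj j theta) / mu)).

Definition next2 {S : nat} (Theta : set 'cV[R]_d) (mu rho : R)
    (Phat : 'cV[R]_d -> refdist R S 'M[R]_(N + 1)) (eta : 'cV[R]_d) :
  set 'cV[R]_d := argmin Theta (J2 mu rho (Phat eta)).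

Definition Gammaj (j : 'I_J) (theta : 'cV[R]_d) : 'M[R]_(N + 1) :=
  block_mx (aj j theta *m (aj j theta)^T) (bj j theta)
           ((bj j theta)^T) (cj j theta)%:M.

Definition dGammaj (i : 'I_d) (j : 'I_J) (theta : 'cV[R]_d) : 'M[R]_(N + 1) :=
  \matrix_(r, c) pderiv i (fun th => Gammaj j th r c) theta.

Definition model2_bounds {S : nat} (Theta : set 'cV[R]_d)
    (Phat : 'cV[R]_d -> refdist R S 'M[R]_(N + 1)) (k1 k2 k3 : R) : Prop :=
  [/\ forall theta Z, Theta theta -> supp (Phat theta) Z -> frob Z <= k1,
      forall theta j, Theta theta -> frob (Gammaj j theta) <= k2 &
      forall theta i j, Theta theta -> frob (dGammaj i j theta) <= k3].

(* The set of eigenvalues of a symmetric matrix of positive size is finite and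
   nonempty, so the infimum is the least eigenvalue. *)
Definition lambda_min {n : nat} (A : 'M[R]_n) : R :=
  inf [set a : R | eigenvalue A a].

(* The infimum runs over finitely many pieces, i.e. it is min_j. *)
Definition alpha2 : R :=
  2 * inf (range (fun j => lambda_min ((Abar M j)^T *m Abar M j))).

End Model2.

Definition posdef {R : realType} {n : nat} (A : 'M[R]_n) : Prop :=
  forall x : 'cV[R]_n, x != 0 -> 0 < (x^T *m A *m x) 0 0.

(* *** Model 3 *)

Section Model3.
Context {R : realType} {d m : nat}.
Variables (Z : set 'cV[R]_m) (loss : 'cV[R]_m -> 'cV[R]_d -> R).

(* The loss matters on Z only, where it is finite: as a function of z it is
   extended by -oo, which makes it proper when Z is nonempty. *)
Definition ext_loss (theta : 'cV[R]_d) (z : 'cV[R]_m) : \bar R :=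
  if z \in Z then (loss z theta)%:E else -oo%E.

Definition usc_loss (Theta : set 'cV[R]_d) : Prop :=
  forall theta, Theta theta ->
    lower_semicontinuous (fun z => (- ext_loss theta z)%E).

Definition concave_loss (Theta : set 'cV[R]_d) : Prop :=
  forall theta, Theta theta -> convex_function Z (fun z => - loss z theta).

Definition distances : set R := [set frob (z - z') | z in Z & z' in Z].

Definition diam : R := sup distances.

(* The real supremum is the true one: a usc concave loss is bounded above on a
   closed set Z of finite diameter. *)
Definition J3 {S : nat} (rho tau : R) (P : refdist R S 'cV[R]_m)
    (x : 'cV[R]_d * R) : R :=
  \sum_s prob P s *
    sup [set loss z x.1 - x.2 * frob (z - atom P s) ^+ 2 | z in Z]
  + rho ^+ 2 * x.2 + tau * x.2 ^+ 2.

(* The regularized problem is minimized jointly in (theta, lambda); only the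
   theta component is fed back. *)
Definition next3 {S : nat} (Theta : set 'cV[R]_d) (rho tau : R)
    (Phat : 'cV[R]_d -> refdist R S 'cV[R]_m) (eta : 'cV[R]_d) :
  set 'cV[R]_d :=
  [set theta | exists lambda : R,
     argmin (Theta `*` [set l : R | 0 <= l]) (J3 rho tau (Phat eta))
            (theta, lambda)].

End Model3.

(* Main.v *)
Require Import Defs.
From HB Require Import structures.
From mathcomp Require Import all_boot all_order all_algebra.
From mathcomp Require Import all_classical all_reals all_analysis.
From mathcomp Require Import ring lra.

Set Implicit Arguments.
Unset Strict Implicit.
Unset Printing Implicit Defensive.

Import Order.TTheory GRing.Theory Num.Theory.
Import numFieldNormedType.Exports.

Local Open Scope classical_set_scope.
Local Open Scope ring_scope.

(** In all three models the objective minimized at a deployed decision is an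
expectation, under the reference distribution, of a function [phi z x] plus a
regularizer, and it is [c]-strongly convex in the decision [x]. The step map is
therefore Lipschitz for a reason common to the three models. If [u] minimizes
[f] (built on [P]) and [v] minimizes [g] (built on [Q]), quadratic growth of
both functions around their minimizers gives
  [c |u - v|^2 <= (f v - f u) + (g u - g v) = E_P h - E_Q h]
with [h z = phi z v - phi z u]. When [h] is [k |u - v|]-Lipschitz in [z], the
easy half of Kantorovich duality ([expectation_diff_le_W1]) bounds the right
side by [k |u - v| W1(P, Q)], hence [c |u - v| <= k W1(P, Q)]
([argmin_dist_le_W1]), and sensitivity of the reference map turns this into the
Lipschitz constant [eps * (k / c)]. Below 1, Banach's fixed point argument
gives the stable point and the rate. What the models have to supply is the
strong convexity constant [c], a minimizer, and the mixed Lipschitz constant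
[k].

Strong convexity is used in the form of a quadratic minorant touching the
function at each point of the domain ([strongly_subdiff]). It passes to
averages, sums, suprema and log-sum-exp, makes minimizing sequences Cauchy, and
already contains the semicontinuity needed at their limit, so that minimizers
exist on every closed convex set ([minimizer_exists]).

Model 1: [c] is [gamma] plus the contribution [2 rho L] of the Tikhonov term,
and [k = beta] by the mean value inequality applied to [loss z - loss z'].

Model 2: the pieces are [Qj Z x = <Z, Gammaj x>], with [Gammaj] quadratic in
[x], and the penalty is [rho <I, Gammaj x>], whose second-order part is [rho
|Abar v|^2 >= rho (alpha / 2) |v|^2]; log-sum-exp preserves both strong
convexity and plain convexity. For [k], the mean value inequality is applied
first in [x] and then in [Z]: the derivative in [Z] of the softmax average of
the numbers [<Z, G_j>] is an average plus a softmax covariance divided by [mu].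

Model 3: the decision is the pair [(theta, lambda)]. The scenario attaining the
inner supremum is a proximal point, hence a nonexpansive function of the
reference atom and, for [lambda] away from 0, a Lipschitz function of the
decision ([maximizer_dist]). Along a short segment of decisions this yields the
mixed Lipschitz bound up to a second-order error, which disappears under
subdivision of the segment; the boundary [lambda = 0] is reached by a limit. *)

(** * Frobenius inner product *)

Section Frobenius.
Context {R : realType} {m n : nat}.
Implicit Types A B C : 'M[R]_(m, n).

Definition dot A B : R := \sum_i \sum_j A i j * B i j.

Lemma dotC A B : dot A B = dot B A.
Proof. by apply: eq_bigr => i _; apply: eq_bigr => j _; rewrite mulrC. Qed.

Lemma dotDl A B C : dot (A + B) C = dot A C + dot B C.
Proof.
rewrite -big_split; apply: eq_bigr => i _ /=; rewrite -big_split.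
by apply: eq_bigr => j _; rewrite mxE mulrDl.
Qed.

Lemma dotZl a A B : dot (a *: A) B = a * dot A B.
Proof.
rewrite mulr_sumr; apply: eq_bigr => i _; rewrite mulr_sumr.
by apply: eq_bigr => j _; rewrite mxE mulrA.
Qed.

Lemma dotNl A B : dot (- A) B = - dot A B.
Proof. by rewrite -scaleN1r dotZl mulN1r. Qed.

Lemma dotBl A B C : dot (A - B) C = dot A C - dot B C.
Proof. by rewrite dotDl dotNl. Qed.

Lemma dot0l A : dot 0 A = 0.
Proof. by rewrite -(scale0r 0) dotZl mul0r. Qed.

Lemma dotDr A B C : dot A (B + C) = dot A B + dot A C.
Proof. by rewrite dotC dotDl !(dotC A). Qed.

Lemma dotZr a A B : dot A (a *: B) = a * dot A B.
Proof. by rewrite dotC dotZl dotC. Qed.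

Lemma dotNr A B : dot A (- B) = - dot A B.
Proof. by rewrite dotC dotNl dotC. Qed.

Lemma dotBr A B C : dot A (B - C) = dot A B - dot A C.
Proof. by rewrite dotDr dotNr. Qed.

Lemma dot0r A : dot A 0 = 0.
Proof. by rewrite dotC dot0l. Qed.

Lemma dot_suml I (r : seq I) (P : pred I) (F : I -> 'M[R]_(m, n)) B :
  dot (\sum_(i <- r | P i) F i) B = \sum_(i <- r | P i) dot (F i) B.
Proof.
by elim/big_rec2 : _ => [|i y x _ <-]; rewrite ?dot0l ?dotDl.
Qed.

Lemma dot_ge0 A : 0 <= dot A A.
Proof. by do 2!(apply: sumr_ge0 => ? _); rewrite -expr2 sqr_ge0. Qed.

Lemma frob_ge0 A : 0 <= frob A. Proof. exact: sqrtr_ge0. Qed.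

Lemma frob_sqr A : frob A ^+ 2 = dot A A.
Proof.
rewrite sqr_sqrtr; last by do 2!(apply: sumr_ge0 => ? _); exact: sqr_ge0.
by apply: eq_bigr => i _; apply: eq_bigr => j _; rewrite expr2.
Qed.

Lemma frob_le A b : 0 <= b -> dot A A <= b ^+ 2 -> frob A <= b.
Proof. by move=> b0; rewrite -frob_sqr ler_sqr ?nnegrE ?frob_ge0. Qed.

Lemma frobN A : frob (- A) = frob A.
Proof.
congr Num.sqrt; apply: eq_bigr => i _; apply: eq_bigr => j _.
by rewrite mxE sqrrN.
Qed.

Lemma frobBC A B : frob (A - B) = frob (B - A).
Proof. by rewrite -frobN opprB. Qed.

Lemma frob0 : frob (0 : 'M[R]_(m, n)) = 0.
Proof. by apply/eqP; rewrite -sqrf_eq0 frob_sqr dot0l. Qed.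

Lemma frobZ a A : frob (a *: A) = `|a| * frob A.
Proof.
apply/eqP; rewrite -(@eqrXn2 _ 2) ?mulr_ge0 ?frob_ge0//.
by rewrite exprMn !frob_sqr dotZl dotZr mulrA -expr2 real_normK ?num_real.
Qed.

Lemma coord_le_frob A i j : `|A i j| <= frob A.
Proof.
rewrite -(@ler_pXn2r _ 2) ?nnegrE ?frob_ge0// frob_sqr real_normK ?num_real//.
rewrite /dot (bigD1 i)//= (bigD1 j)//= -expr2 -addrA lerDl addr_ge0//.
  by apply: sumr_ge0 => k _; rewrite -expr2 sqr_ge0.
by do 2!(apply: sumr_ge0 => ? _); rewrite -expr2 sqr_ge0.
Qed.

Lemma frob_eq0 A : frob A = 0 -> A = 0.
Proof.
move=> A0; apply/matrixP => i j; rewrite mxE; apply/eqP.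
by rewrite -normr_le0 -A0 coord_le_frob.
Qed.

Lemma dot_le A B : dot A B <= frob A * frob B.
Proof.
have [/frob_eq0 ->|a0] := eqVneq (frob A) 0.
  by rewrite dot0l frob0 mul0r.
have [/frob_eq0 ->|b0] := eqVneq (frob B) 0.
  by rewrite dot0r frob0 mulr0.
have ab0 : 0 < frob A * frob B.
  by rewrite mulr_gt0// lt_neqAle eq_sym ?a0 ?b0 frob_ge0.
have := dot_ge0 (frob B *: A - frob A *: B).
rewrite !(dotBl, dotBr, dotZl, dotZr) -!frob_sqr (dotC B A) => h.
rewrite -(ler_pM2l ab0); move: h; set a := frob A; set b := frob B.
nra.
Qed.

Lemma normr_dot_le A B : `|dot A B| <= frob A * frob B.
Proof. by rewrite ler_norml dot_le andbT lerNl -dotNl -(frobN A) dot_le. Qed.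

Lemma frobD A B : frob (A + B) <= frob A + frob B.
Proof.
apply: frob_le; first by rewrite addr_ge0 ?frob_ge0.
rewrite !(dotDl, dotDr) -!frob_sqr (dotC B A).
have := dot_le A B; nra.
Qed.

Lemma frobB A B : frob (A - B) <= frob A + frob B.
Proof. by rewrite -(frobN B) frobD. Qed.

Lemma ler_frob_dist A B : frob A - frob B <= frob (A - B).
Proof. by rewrite lerBlDr -[in leLHS](subrK B A) frobD. Qed.

Lemma frob_sum_le I (r : seq I) (P : pred I) (F : I -> 'M[R]_(m, n)) :
  frob (\sum_(i <- r | P i) F i) <= \sum_(i <- r | P i) frob (F i).
Proof.
elim/big_rec2 : _ => [|i y x _ h]; first by rewrite frob0.
by apply: le_trans (frobD _ _) _; rewrite lerD2l.
Qed.

Lemma frob_le_sum A : frob A <= \sum_i \sum_j `|A i j|.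
Proof.
have -> : frob A = frob (\sum_i \sum_j A i j *: delta_mx i j).
  by rewrite -matrix_sum_delta.
apply: le_trans (frob_sum_le _ _ _) _; apply: ler_sum => i _.
apply: le_trans (frob_sum_le _ _ _) _; apply: ler_sum => j _.
rewrite frobZ ler_piMr//; apply: frob_le => //.
rewrite /dot (bigD1 i)//= (bigD1 j)//= big1 ?addr0 => [|k kj]; last first.
  by rewrite mxE (negPf kj) andbF mul0r.
rewrite mxE !eqxx mulr1 expr1n big1 ?addr0// => k ki.
by rewrite big1// => l _; rewrite mxE (negPf ki) mul0r.
Qed.

End Frobenius.

Lemma mul_tr_dot {R : realType} {n} (x y : 'cV[R]_n) :
  (x^T *m y) 0 0 = dot x y.
Proof. by rewrite mxE; apply: eq_bigr => i _; rewrite big_ord1 mxE. Qed.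

Lemma dot_col_mx {R : realType} {m n p} (A A' : 'M[R]_(m, p))
    (B B' : 'M[R]_(n, p)) :
  dot (col_mx A B) (col_mx A' B') = dot A A' + dot B B'.
Proof.
rewrite /dot big_split_ord/=; congr (_ + _); apply: eq_bigr => i _;
  by apply: eq_bigr => j _; rewrite ?col_mxEu ?col_mxEd.
Qed.


Lemma frob_triangle {R : realType} {m n} (A B C : 'M[R]_(m, n)) :
  frob (A - C) <= frob (A - B) + frob (B - C).
Proof. by rewrite -[A - C](_ : A - B + (B - C) = _) ?frobD// addrA subrK. Qed.

Lemma mx_norm_le_frob {R : realType} {m n} (A : 'M[R]_(m, n)) :
  `|A| <= frob A.
Proof.
rewrite [leLHS]/Num.norm/= mx_normrE; apply/bigmax_leP; split=> [|ij _].
  exact: frob_ge0.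
exact: coord_le_frob.
Qed.

Lemma coord_le_mx_norm {R : realType} {m n} (A : 'M[R]_(m, n)) i j :
  `|A i j| <= `|A|.
Proof.
rewrite [leRHS]/Num.norm/= mx_normrE.
exact: (@le_bigmax _ _ _ _ (fun ij : 'I_m * 'I_n => `|A ij.1 ij.2|) (i, j)).
Qed.

Lemma frob_le_mx_norm {R : realType} {m n} (A : 'M[R]_(m, n)) :
  frob A <= (m * n)%:R * `|A|.
Proof.
apply: le_trans (frob_le_sum A) _.
have -> : (m * n)%:R * `|A| = \sum_(i < m) \sum_(j < n) `|A|.
  by rewrite !sumr_const !card_ord -mulr_natl -mulr_natr natrM; ring.
by apply: ler_sum => i _; apply: ler_sum => j _; exact: coord_le_mx_norm.
Qed.

(** The form of completeness used for minimizing sequences and for orbits of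
the step map: both come with an explicit rate in the Euclidean norm, whereas
the topology of matrices is that of the sup norm. *)
Lemma frob_complete {R : realType} {m n} (X : set 'M[R]_(m, n))
    (x : nat -> 'M[R]_(m, n)) (r : nat -> R) :
  closed X -> (forall k, X (x k)) -> r @ \oo --> (0 : R) ->
  (forall k l, (k <= l)%N -> frob (x k - x l) <= r k) ->
  exists2 a, X a &
    forall e : R, 0 < e -> \forall k \near \oo, frob (x k - a) < e.
Proof.
move=> clX Xx r0 xr.
have xcvg : cvg (x @ \oo).
  suff : cauchy (x @ \oo) by exact: cauchy_cvg.
  apply: cauchy_exP => e e0.
  have [N _ Nr] : \forall k \near \oo, r k < e by apply: cvgr_lt r0 _ e0.
  exists (x N), N => // k /= Nk; rewrite -ball_normE /=.
  apply: le_lt_trans (mx_norm_le_frob _) _.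
  by apply: le_lt_trans (xr _ _ Nk) _; apply: Nr => /=.
exists (lim (x @ \oo)); first by apply: (closed_cvg _ clX) xcvg; exact: nearW.
move=> e e0; have mn0 : (0 : R) < (m * n).+1%:R by [].
move/cvgrPdist_lt: (xcvg) => /(_ _ (divr_gt0 e0 mn0)).
move/filterS; apply => k; rewrite distrC ltr_pdivlMr// => h.
apply: le_lt_trans (frob_le_mx_norm _) _; apply: le_lt_trans h.
by rewrite mulrC ler_wpM2l// ler_nat.
Qed.

(** * Strong convexity *)

Section StrongConvexity.
Context {R : realType} {n : nat}.
Implicit Types (X : set 'cV[R]_n) (f : 'cV[R]_n -> R) (x y u : 'cV[R]_n).

Let segmentE x y (t : R) : x + t *: (y - x) = t *: y + (1 - t) *: x.
Proof. by rewrite scalerBr scalerBl scale1r addrCA. Qed.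

Lemma convex_set_segment X x y (t : R) : convex_set X -> X x -> X y ->
  0 <= t -> t <= 1 -> X (x + t *: (y - x)).
Proof.
move=> cX Xx Xy t0 t1; have := cX y x (Itv01 t0 t1).
by rewrite !inE segmentE => /(_ Xy Xx).
Qed.

Lemma segment_convex_set X :
  (forall x y (t : R), X x -> X y -> 0 <= t -> t <= 1 ->
     X (x + t *: (y - x))) -> convex_set X.
Proof.
move=> segX x y l; rewrite !inE => Xx Xy; have := segX y x l%:num Xy Xx.
by rewrite segmentE; apply.
Qed.

Lemma convex_function_segment X f x y (t : R) :
  convex_function X f -> X x -> X y ->
  0 <= t -> t <= 1 -> f (x + t *: (y - x)) <= (1 - t) * f x + t * f y.
Proof.
move=> cf Xx Xy t0 t1; rewrite segmentE [leRHS]addrC.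
by apply: (cf (Itv01 t0 t1) y x); rewrite inE.
Qed.

(** Strong convexity with modulus [m], as the existence at every point of a
quadratic minorant that touches the function there. In this form, which asks
for no derivative, it passes to suprema. *)
Definition strongly_subdiff (m : R) X f := forall x, X x ->
  exists g, forall y, X y ->
    f x + dot g (y - x) + m / 2 * frob (y - x) ^+ 2 <= f y.

(** The hypothesis is restricted to positive weights because the assumptions on
a loss concern the support of the distribution, not all its atoms. *)
Lemma strongly_subdiff_sum {I : finType} (w : I -> R) (F : I -> 'cV[R]_n -> R)
    m X : (forall i, 0 <= w i) -> \sum_i w i = 1 ->
  (forall i, 0 < w i -> strongly_subdiff m X (F i)) ->
  strongly_subdiff m X (fun x => \sum_i w i * F i x).
Proof.
move=> w0 w1 sF x Xx.
have /choice[g gP] : forall i, exists g, 0 < w i -> forall y, X y ->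
    F i x + dot g (y - x) + m / 2 * frob (y - x) ^+ 2 <= F i y.
  move=> i; have [wi|_] := ltP 0 (w i); last by exists 0.
  by have [g gP] := sF i wi x Xx; exists g.
exists (\sum_i w i *: g i) => y Xy.
set c := m / 2 * _.
rewrite (_ : c = \sum_i w i * c) ?dot_suml -?big_split/=; last first.
  by rewrite -mulr_suml w1 mul1r.
apply: ler_sum => i _; rewrite dotZl -!mulrDr.
have [wi|] := ltP 0 (w i); first by rewrite ler_wpM2l//; exact: gP.
by move=> wi; rewrite (_ : w i = 0) ?mul0r//; apply/eqP; rewrite eq_le wi w0.
Qed.

Lemma strongly_subdiffD (m1 m2 m : R) X f1 f2 : m = m1 + m2 ->
  strongly_subdiff m1 X f1 -> strongly_subdiff m2 X f2 ->
  strongly_subdiff m X (fun x => f1 x + f2 x).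
Proof.
move=> -> s1 s2 x Xx; have [g1 P1] := s1 x Xx; have [g2 P2] := s2 x Xx.
exists (g1 + g2) => y Xy; have := P1 y Xy; have := P2 y Xy.
by rewrite dotDl; lra.
Qed.

(** The same notion without gradients, in the form that a loss concave in [z]
provides and that growth at a minimizer requires. *)
Definition strongly_convex_on (m : R) X f := forall x y (t : R),
  X x -> X y -> 0 <= t -> t <= 1 ->
  f (x + t *: (y - x)) + m / 2 * (t * (1 - t)) * frob (y - x) ^+ 2
    <= (1 - t) * f x + t * f y.

(** Average, with weights [1 - t] and [t], the two minorants at the
intermediate point evaluated at the end points; the linear terms cancel. *)
Lemma strongly_subdiff_convex_on (m : R) X f : convex_set X ->
  strongly_subdiff m X f -> strongly_convex_on m X f.
Proof.
move=> cX sf x y t Xx Xy t0 t1; set z := x + _.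
have [g gP] := sf z (convex_set_segment cX Xx Xy t0 t1).
have xz : x - z = - t *: (y - x).
  by rewrite /z opprD addrA subrr sub0r scaleNr.
have yz : y - z = (1 - t) *: (y - x).
  by rewrite /z opprD addrA scalerBl scale1r.
have := gP x Xx; have := gP y Xy.
rewrite xz yz !dotZr !frobZ !exprMn !real_normK ?num_real//.
set d := dot _ _; set N := frob _ ^+ 2 => h1 h2.
have t1' : 0 <= 1 - t by rewrite subr_ge0.
have {h1} := ler_wpM2l t0 h1; have {h2} := ler_wpM2l t1' h2.
move=> h2 h1; have := lerD h2 h1; apply: le_trans.
by rewrite le_eqVlt; apply/orP; left; apply/eqP; field.
Qed.

(** Strong convexity on the segment from the minimizer [u] to [x] gives [(1 -
t) m / 2 |x - u|^2 <= f x - f u] for every small [t > 0]. *)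
Lemma minimizer_growth (m : R) X f u x :
  convex_set X -> strongly_convex_on m X f ->
  argmin X f u -> X x -> f u + m / 2 * frob (x - u) ^+ 2 <= f x.
Proof.
move=> cX sf [Xu fu] Xx; rewrite -lerBrDl.
have a0 : 0 <= f x - f u by rewrite subr_ge0 fu.
set a := f x - f u in a0 *; set c := m / 2 * _.
rewrite leNgt; apply/negP => ac.
have c0 : 0 < c by exact: le_lt_trans ac.
have c2 : 0 < 2 * c by rewrite mulr_gt0.
(* a step small enough for [a < (1 - t) * c] *)
have [t tc] : exists t, t * (2 * c) = c - a.
  by exists ((c - a) / (2 * c)); rewrite divfK// gt_eqF.
have t0 : 0 < t by rewrite -(pmulr_lgt0 _ c2) tc subr_gt0.
have t1 : t <= 1 by rewrite -(ler_pM2r c2) tc mul1r; clearbody a c; lra.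
have := sf _ _ _ Xu Xx (ltW t0) t1.
have := fu _ (convex_set_segment cX Xu Xx (ltW t0) t1).
move=> h1 h2; have {h1 h2} h : t * ((1 - t) * c) <= t * a.
  by rewrite /a /c; lra.
have {h} := h; rewrite ler_pM2l// => h; lra.
Qed.

(** By strong convexity at midpoints, two nearly minimal points are close, so
minimizing sequences are Cauchy; the minorant at the limit shows that nothing
is lost there. The minorant at any point bounds [f] below. *)
Lemma minimizer_exists (m : R) X f :
  X !=set0 -> closed X -> convex_set X -> 0 < m ->
  strongly_subdiff m X f -> argmin X f !=set0.
Proof.
move=> [x0 Xx0] clX cX m0 sf.
have m0' : m != 0 by rewrite gt_eqF.
pose V := f @` X.
have lbV : has_lbound V.
  have [g gP] := sf x0 Xx0.
  exists (f x0 - (frob g) ^+ 2 / (2 * m)) => _ [x Xx <-].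
  apply: le_trans (gP x Xx); set b := frob (x - x0).
  have h : - (frob g * b) <= dot g (x - x0).
    by rewrite lerNl -dotNl -(frobN g) dot_le.
  suff : 0 <= (frob g ^+ 2 / (2 * m)) - frob g * b + m / 2 * b ^+ 2 by lra.
  have -> : (frob g ^+ 2 / (2 * m)) - frob g * b + m / 2 * b ^+ 2 =
      (frob g - m * b) ^+ 2 / (2 * m) by field.
  by rewrite divr_ge0 ?sqr_ge0// mulr_ge0// ltW.
have infV : has_inf V by split => //; exists (f x0); exists x0.
have /choice[x xP] : forall k : nat, exists x, X x /\ f x < inf V + k.+1%:R^-1.
  move=> k; have k0 : (0 : R) < k.+1%:R^-1 by rewrite invr_gt0.
  by have [_ [x Xx <-] fx] := inf_adherent k0 infV; exists x.
have Vle y : X y -> inf V <= f y by move=> Xy; apply: ge_inf => //; exists y.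
(* the bound [m / 8 * |x k - x l|^2 <= k.+1^-1] from the midpoint inequality *)
pose r k : R := Num.sqrt (8 / m * k.+1%:R^-1).
have r0 : r @ \oo --> (0 : R).
  rewrite -(sqrtr0 R); apply: continuous_cvg; first exact: sqrt_continuous.
  rewrite -(mulr0 (8 / m)); apply: cvgM; first exact: cvg_cst.
  exact: cvg_harmonic.
have cau k l : (k <= l)%N -> frob (x k - x l) <= r k.
  move=> kl; rewrite -(@ler_pXn2r _ 2) ?nnegrE ?frob_ge0 ?sqrtr_ge0//.
  rewrite [r k ^+ 2]sqr_sqrtr; last by rewrite mulr_ge0 ?divr_ge0// ltW.
  have [Xk fk] := xP k; have [Xl fl] := xP l.
  have h0 : (0 : R) <= 2^-1 by [].
  have h1 : 2^-1 <= (1 : R) by lra.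
  have := strongly_subdiff_convex_on cX sf Xl Xk h0 h1.
  have := Vle _ (convex_set_segment cX Xl Xk h0 h1).
  have lk : l.+1%:R^-1 <= k.+1%:R^-1 :> R.
    by rewrite lef_pV2 ?posrE// ler_nat ltnS.
  rewrite (mulrAC 8) ler_pdivlMr//.
  move: lk fk fl; set N := frob _ ^+ 2.
  set p := k.+1%:R^-1; set q := l.+1%:R^-1.
  set a := f _; set b := f _; set c := f _; set v := inf V; lra.
have [a Xa aP] := frob_complete clX (fun k => (xP k).1) r0 cau.
exists a; split=> // y Xy; apply: le_trans (Vle y Xy).
have [g gP] := sf a Xa.
apply/ler_addgt0Pr => e e0.
have g1 : 0 < frob g + 1 by rewrite ltr_pwDr// frob_ge0.
have e2 : 0 < e / 2 by rewrite divr_gt0.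
have ha := aP _ (divr_gt0 e2 g1).
have hb : \forall k \near \oo, (k.+1%:R^-1 : R) < e / 2.
  by apply: (cvgr_lt _ (@cvg_harmonic R)); rewrite divr_gt0.
near \oo => k.
have : frob (x k - a) < e / 2 / (frob g + 1) by near: k.
have : (k.+1%:R^-1 : R) < e / 2 by near: k.
have [Xk fk] := xP k; have := gP _ Xk.
have : 0 <= m / 2 * frob (x k - a) ^+ 2.
  by rewrite mulr_ge0 ?sqr_ge0 ?divr_ge0// ltW.
have : - (frob g * frob (x k - a)) <= dot g (x k - a).
  by rewrite lerNl -dotNl -(frobN g) dot_le.
rewrite (ltr_pdivlMr _ _ g1); have := frob_ge0 g; have := frob_ge0 (x k - a).
move: fk; set b := frob (x k - a); set G := frob g; set q := (_.+1%:R^-1).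
set D := dot _ _; set Q := m / 2 * _; lra.
Unshelve. all: by end_near. Qed.

End StrongConvexity.

(** * Wasserstein distance and minimizers *)

(** Writing both expectations as sums over a coupling compares [h] at the two
ends of each transported pair. Pairs of positive mass join points of the two
supports, where the Lipschitz bound is assumed. *)
Lemma expectation_diff_le_W1 {R : realType} {S m n : nat}
    (P Q : refdist R S 'M[R]_(m, n)) (h : 'M[R]_(m, n) -> R) (K : R) :
  0 <= K ->
  (forall z z', supp P z -> supp Q z' -> h z - h z' <= K * frob (z - z')) ->
  \sum_s prob P s * h (atom P s) - \sum_s prob Q s * h (atom Q s)
    <= K * W1 P Q.
Proof.
move=> K0 hK; set D := _ - _.
have cost pi : coupling P Q pi ->
    D <= K * (\sum_s \sum_t pi s t * frob (atom P s - atom Q t)).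
  move=> [pi0 piP piQ].
  have -> : D = \sum_s \sum_t pi s t * (h (atom P s) - h (atom Q t)).
    rewrite /D.
    under eq_bigr do rewrite -piP mulr_suml.
    under [X in _ - X]eq_bigr do rewrite -piQ mulr_suml.
    rewrite [X in _ - X]exchange_big -sumrB; apply: eq_bigr => s _.
    by rewrite -sumrB; apply: eq_bigr => t _; rewrite mulrBr.
  rewrite mulr_sumr; apply: ler_sum => s _.
  rewrite mulr_sumr; apply: ler_sum => t _.
  have [->|pist] := eqVneq (pi s t) 0; first by rewrite !mul0r mulr0.
  have pi_gt0 : 0 < pi s t by rewrite lt_neqAle eq_sym pist pi0.
  rewrite mulrCA ler_wpM2l//; apply: hK; [exists s|exists t] => //=.
    rewrite -piP (bigD1 t)//=; apply: ltr_pwDl => //.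
    by apply: sumr_ge0 => *.
  rewrite -piQ (bigD1 s)//=; apply: ltr_pwDl => //.
  by apply: sumr_ge0 => *.
(* the infimum defining [W1] is over a nonempty set *)
have prodPQ : coupling P Q (\matrix_(s, t) (prob P s * prob Q t)).
  split=> [s t|s|t].
  - by rewrite mxE mulr_ge0 ?prob_ge0.
  - by under eq_bigr do rewrite mxE; rewrite -mulr_sumr prob_sum1 mulr1.
  - by under eq_bigr do rewrite mxE; rewrite -mulr_suml prob_sum1 mul1r.
have [K_gt0|K_le0] := ltP 0 K; last first.
  have K00 : K = 0 by apply/eqP; rewrite eq_le K_le0.
  by have := cost _ prodPQ; rewrite K00 !mul0r.
rewrite -ler_pdivrMl//; apply: lb_le_inf.
  by eexists; eexists; first exact: prodPQ.
by move=> _ [pi cpi <-]; rewrite ler_pdivrMl//; exact: cost.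
Qed.

(** The comparison of two minimizers that drives all three models: add the
growth inequalities of [f] at [u] and of [g] at [v]. The regularizer [r]
cancels, and what remains is the difference of two expectations of the same
function. *)
Lemma argmin_dist_le_W1 {R : realType} {n S p q : nat} (X : set 'cV[R]_n)
    (P Q : refdist R S 'M[R]_(p, q)) (phi : 'M[R]_(p, q) -> 'cV[R]_n -> R)
    (r f g : 'cV[R]_n -> R) (c k : R) (u v : 'cV[R]_n) :
  convex_set X -> 0 <= k ->
  (forall x, f x = \sum_s prob P s * phi (atom P s) x + r x) ->
  (forall x, g x = \sum_s prob Q s * phi (atom Q s) x + r x) ->
  strongly_subdiff c X f -> strongly_subdiff c X g ->
  argmin X f u -> argmin X g v ->
  (forall z z', supp P z -> supp Q z' ->
     (phi z v - phi z u) - (phi z' v - phi z' u)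
       <= k * frob (u - v) * frob (z - z')) ->
  c * frob (u - v) <= k * W1 P Q.
Proof.
move=> cX k0 fE gE sf sg mu mv hphi.
have W0 : 0 <= W1 P Q.
  rewrite /W1; have [->|/set0P ne] := eqVneq (coupling P Q) set0.
    by rewrite image_set0 inf0.
  apply: lb_le_inf; first by case: ne => pi cpi; eexists; exists pi.
  move=> _ [pi [pi0 _ _] <-]; do 2!(apply: sumr_ge0 => ? _).
  by rewrite mulr_ge0 ?frob_ge0.
have [->|uv] := eqVneq (frob (u - v)) 0; first by rewrite mulr0 mulr_ge0.
have uv0 : 0 < frob (u - v) by rewrite lt_neqAle eq_sym uv frob_ge0.
rewrite -(ler_pM2r uv0).
have := minimizer_growth cX (strongly_subdiff_convex_on cX sf) mu mv.1.
have := minimizer_growth cX (strongly_subdiff_convex_on cX sg) mv mu.1.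
have := expectation_diff_le_W1 (mulr_ge0 k0 (ltW uv0)) hphi.
rewrite !fE !gE (frobBC v u).
have splitE (F G w : 'I_S -> R) : \sum_s w s * (F s - G s) =
   (\sum_s w s * F s) - \sum_s w s * G s.
  by rewrite -sumrB; apply: eq_bigr => s _; rewrite mulrBr.
by rewrite !splitE; lra.
Qed.

(** * Fixed points of contracting step maps *)

Section Banach.
Context {R : realType} {d : nat}.
Variables (Theta : set 'cV[R]_d) (next : 'cV[R]_d -> set 'cV[R]_d) (k : R).
Hypotheses (Theta0 : Theta !=set0) (clTheta : closed Theta).
Hypotheses (next0 : forall x, Theta x -> next x !=set0)
  (nextT : forall x u, Theta x -> next x u -> Theta u).
Hypotheses (kstep : step_lipschitz Theta next k) (k0 : 0 <= k) (k1 : k < 1).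

(** The orbit of a choice [T] of next iterates is Cauchy, and its limit is
fixed by [T] because [T] is [k]-Lipschitz. *)
Lemma stable_exists : exists a, stable Theta next a.
Proof.
have k1' : 0 < 1 - k by rewrite subr_gt0.
have /choice[T TP] : forall x, exists u, Theta x -> next x u.
  move=> x; have [Tx|] := pselect (Theta x); last by exists x.
  by have [u xu] := next0 Tx; exists u.
have [x0 Tx0] := Theta0; pose x j := iter j T x0.
have Tx j : Theta (x j).
  by elim: j => //= j ih; apply: nextT (TP _ ih).
have Tk a b : Theta a -> Theta b -> frob (T a - T b) <= k * frob (a - b).
  by move=> Ta Tb; apply: kstep (TP _ Ta) (TP _ Tb).
pose D := frob (x 0 - x 1).
have D0 : 0 <= D by exact: frob_ge0.
have xS j : frob (x j - x j.+1) <= k ^+ j * D.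
  elim: j => [|j ih]; first by rewrite mul1r.
  apply: le_trans (Tk _ _ (Tx j) (Tx j.+1)) _.
  by rewrite exprS -mulrA ler_wpM2l.
have cau i j : (i <= j)%N -> frob (x i - x j) <= D / (1 - k) * k ^+ i.
  move=> /subnKC <-; move: (j - i)%N => {}j.
(* the sum of the geometric series between [i] and [i + j] *)
  suff : frob (x i - x (i + j)%N) <= D / (1 - k) * (k ^+ i - k ^+ (i + j)).
    move=> /le_trans; apply; rewrite ler_wpM2l ?divr_ge0 ?(ltW k1')//.
    by rewrite gerBl exprn_ge0.
  elim: j => [|j ih]; first by rewrite addn0 !subrr frob0 mulr0.
  rewrite addnS; apply: le_trans (frob_triangle _ (x (i + j)%N) _) _.
  apply: le_trans (lerD ih (xS _)) _; rewrite exprS le_eqVlt.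
  by apply/orP; left; apply/eqP; field; rewrite gt_eqF.
have r0 : (fun i => D / (1 - k) * k ^+ i) @ \oo --> (0 : R).
  by apply: cvg_geometric; rewrite ger0_norm.
have [a Ta aP] := frob_complete clTheta Tx r0 cau.
exists a; split=> //; suff -> : next a a = next a (T a) by exact: TP.
congr (next a); apply/esym/eqP; rewrite -subr_eq0; apply/eqP/frob_eq0.
apply/eqP; rewrite eq_le frob_ge0 andbT.
apply/ler_addgt0Pr => e e0; rewrite add0r.
have e2 : 0 < e / 2 by rewrite divr_gt0.
have [N _ NP] := aP _ e2.
have h1 : frob (x N - a) < e / 2 by apply: NP => /=.
have h2 : frob (x N.+1 - a) < e / 2 by apply: NP => /=.
apply: le_trans (frob_triangle _ (x N.+1) _) _.
have := Tk _ _ Ta (Tx N); rewrite (frobBC a); have := frob_ge0 (x N - a).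
rewrite -/(x N.+1); nra.
Qed.

Lemma contraction_converges_to_unique_stable :
  converges_to_unique_stable Theta next k.
Proof.
have k1' : 0 < 1 - k by rewrite subr_gt0.
have [a [Ta na]] := stable_exists.
have rate x u : Theta x -> next x u -> frob (u - a) <= k * frob (x - a).
  by move=> Tx xu; apply: kstep xu na.
exists a; split=> // [x [Tx nx]|th [T0 thS]].
  apply/eqP; rewrite -subr_eq0; apply/eqP/frob_eq0.
  have := rate _ _ Tx nx; have := frob_ge0 (x - a); have := k1; nra.
have Tth t : Theta (th t) by elim: t => // t ih; apply: nextT (thS t).
split; first by exists k; split=> // t; apply: rate.
move=> Delta t Delta0 ht.
have pow : frob (th t - a) <= k ^+ t * frob (th 0 - a).
  elim: t {ht} => [|t ih]; first by rewrite mul1r.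
  apply: le_trans (rate _ _ (Tth t) (thS t)) _.
  by rewrite exprS -mulrA ler_wpM2l.
have [r0|r0] := eqVneq (frob (th 0 - a)) 0.
  by apply: le_trans pow _; rewrite r0 mulr0 ltW.
have rpos : 0 < frob (th 0 - a) by rewrite lt_neqAle eq_sym r0 frob_ge0.
(* [k <= exp (k - 1)] turns the geometric rate into an exponential one *)
have kexp : k ^+ t <= expR (- ((1 - k) * t%:R)).
  rewrite -mulNr opprB mulrC expRM_natl.
  apply: lerXn2r; rewrite ?nnegrE ?expR_ge0//.
  by apply: le_trans (expR_ge1Dx _); rewrite addrC subrK.
apply: le_trans pow _.
apply: le_trans (ler_wpM2r (frob_ge0 _) kexp) _.
rewrite expRN mulrC ler_pdivrMr ?expR_gt0// mulrC -ler_pdivrMr//.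
rewrite -[leLHS]lnK ?posrE ?divr_gt0// ler_expR.
by rewrite -ler_pdivrMl.
Qed.

End Banach.

(** * Mean value inequalities *)

Lemma mean_value_le {R : realType} (f df : R -> R) (K : R) :
  (forall t : R, 0 <= t -> t <= 1 -> is_derive t 1 f (df t)) ->
  (forall t : R, 0 <= t -> t <= 1 -> df t <= K) -> f 1 - f 0 <= K.
Proof.
move=> fdf dfK.
have [||c] := @MVT_segment R f df 0 1 ler01.
- by move=> t; rewrite in_itv/= => /andP[/ltW t0 /ltW t1]; exact: fdf.
- apply: derivable_within_continuous => t.
  by rewrite in_itv/= => /andP[t0 t1]; have [] := fdf t t0 t1.
by rewrite in_itv/= => /andP[c0 c1] ->; rewrite subr0 mulr1 dfK.
Qed.

Lemma mean_value_segment {R : realType} {m n} (X : set 'M[R]_(m, n))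
    (F dF : 'M[R]_(m, n) -> R) (u v : 'M[R]_(m, n)) (K : R) :
  (forall t : R, 0 <= t -> t <= 1 -> X (u + t *: (v - u))) ->
  (forall t : R, X (u + t *: (v - u)) ->
     is_derive t 1 (fun s : R => F (u + s *: (v - u)))
       (dF (u + t *: (v - u)))) ->
  (forall x, X x -> dF x <= K) -> F v - F u <= K.
Proof.
move=> segX FdF dFK.
have := @mean_value_le _ (fun s => F (u + s *: (v - u)))
  (fun s => dF (u + s *: (v - u))) K.
rewrite scale1r scale0r addr0 [u + (v - u)]addrC subrK; apply.
  by move=> t t0 t1; apply: FdF; exact: segX.
by move=> t t0 t1; apply: dFK; exact: segX.
Qed.

Lemma derive_grad {R : realType} {d} (f : 'cV[R]_d -> R) (y v : 'cV[R]_d) :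
  differentiable f y -> 'D_v f y = dot (grad f y) v.
Proof.
move=> df; rewrite deriveE// {1}[v]matrix_sum_delta linear_sum/=.
apply: eq_bigr => i _; rewrite !big_ord1 linearZ/= mxE.
by rewrite /pderiv deriveE// mulrC.
Qed.

Lemma is_derive_line {R : realType} {d} (f : 'cV[R]_d -> R) (x v : 'cV[R]_d)
    (t : R) : derivable f (x + t *: v) v ->
  is_derive t 1 (fun s : R => f (x + s *: v)) ('D_v f (x + t *: v)).
Proof.
move=> df.
(* both derivatives are limits of one and the same difference quotient *)
have E : (fun h : R =>
      h^-1 *: ((f \o shift (x + t *: v)) (h *: v) - f (x + t *: v)))
    = (fun h : R => h^-1 *: (((fun s : R => f (x + s *: v)) \o shift t) (h *: 1)
        - f (x + t *: v))).
  apply/funext => h /=; congr (_ *: (f _ - _)).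
  by rewrite addrCA -scalerDl [h *: 1]mulr1.
by split; rewrite /derivable /derive -E.
Qed.

(** The mixed Lipschitz bound of a smooth loss: [loss z - loss z'] has a
gradient of norm at most [beta |z - z'|] all along the segment from [u] to [v].
*)
Lemma smooth_loss_diff {R : realType} {d m n : nat} (Theta : set 'cV[R]_d)
    (Z : set 'M[R]_(m, n)) (loss : 'M[R]_(m, n) -> 'cV[R]_d -> R) (beta : R)
    z z' u v :
  convex_set Theta -> differentiable_loss Theta Z loss ->
  smooth Theta Z loss beta -> Z z -> Z z' -> Theta u -> Theta v ->
  (loss z v - loss z u) - (loss z' v - loss z' u)
    <= beta * frob (u - v) * frob (z - z').
Proof.
move=> cT dl sl Zz Zz' Tu Tv.
have -> (a b c e : R) : a - b - (c - e) = (a - c) - (b - e) by ring.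
apply: (@mean_value_segment _ _ _ Theta (fun x => loss z x - loss z' x)
  (fun x => dot (grad (loss z) x - grad (loss z') x) (v - u))).
- by move=> t; exact: convex_set_segment.
- move=> t Tt; rewrite dotBl -!derive_grad; try exact: dl.
  by apply: is_deriveB; apply: is_derive_line; apply: diff_derivable; exact: dl.
move=> x Tx; apply: le_trans (dot_le _ _) _; rewrite (frobBC v) mulrAC.
by rewrite ler_wpM2r ?frob_ge0//; exact: sl.
Qed.

Lemma supp_prob_gt0 {R : realType} {S : nat} {T : Type} (P : refdist R S T) s :
  0 < prob P s -> supp P (atom P s).
Proof. by move=> ps; exists s. Qed.

Lemma step_lipschitz_argmin {R : realType} {d S p q : nat}
    (Theta : set 'cV[R]_d) (Phat : 'cV[R]_d -> refdist R S 'M[R]_(p, q))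
    (next : 'cV[R]_d -> set 'cV[R]_d) (eps c k : R) :
  0 < c -> 0 <= k ->
  sensitive Theta Phat eps ->
  (forall x y u v, Theta x -> Theta y -> next x u -> next y v ->
     c * frob (u - v) <= k * W1 (Phat x) (Phat y)) ->
  step_lipschitz Theta next (eps * (k / c)).
Proof.
move=> c0 k0 sens h x y u v Tx Ty xu yv.
rewrite -(ler_pM2l c0); apply: le_trans (h _ _ _ _ Tx Ty xu yv) _.
apply: le_trans (ler_wpM2l k0 (sens _ _ Tx Ty)) _.
by rewrite le_eqVlt; apply/orP; left; apply/eqP; field; rewrite gt_eqF.
Qed.

(** * Model 1 *)

Section Model1.
Context {R : realType} {d S : nat}.
Variables (Theta : set 'cV[R]_d) (eps rho : R) (Z : set 'M[R]_(d + 1))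
  (Phat : 'cV[R]_d -> refdist R S 'M[R]_(d + 1)) (Lfun : R -> R)
  (L gamma beta : R).
Hypotheses (Theta0 : Theta !=set0) (clTheta : closed Theta)
  (cTheta : convex_set Theta).
Hypotheses (eps0 : 0 <= eps) (sP : supported_in Theta Phat Z)
  (c0 : 0 < gamma + 2 * rho * L) (beta0 : 0 <= beta).
Hypotheses (dl : differentiable_loss Theta Z (loss1 Lfun))
  (sc : strongly_convex Theta Z (loss1 Lfun) gamma)
  (sl : smooth Theta Z (loss1 Lfun) beta)
  (sens : sensitive Theta Phat eps).

(** The squared norm contributes [2 * rho * L] exactly, because it equals its
second-order expansion. *)
Lemma J1_strongly_subdiff x : Theta x ->
  strongly_subdiff (gamma + 2 * rho * L) Theta (J1 Lfun L rho (Phat x)).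
Proof.
move=> Tx; apply: strongly_subdiffD erefl _ _.
  apply: strongly_subdiff_sum; [exact: prob_ge0|exact: prob_sum1|].
  move=> s ps y Ty; exists (grad (loss1 Lfun (atom (Phat x) s)) y) => z Tz.
  rewrite -mul_tr_dot; apply: sc => //.
  by apply: (sP Tx); exact: supp_prob_gt0.
move=> y _; exists ((2 * (rho * L)) *: y) => z _.
rewrite !frob_sqr !dot_col_mx dotZl !(dotBl, dotBr) (dotC z y).
by rewrite le_eqVlt; apply/orP; left; apply/eqP; field.
Qed.

Lemma model1_contraction :
  let k := eps * (beta / (gamma + 2 * rho * L)) in
  step_lipschitz Theta (next1 Theta Lfun L rho Phat) k /\
  (k < 1 ->
   converges_to_unique_stable Theta (next1 Theta Lfun L rho Phat) k).
Proof.
move=> k.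
have step : step_lipschitz Theta (next1 Theta Lfun L rho Phat) k.
  apply: (step_lipschitz_argmin c0 beta0 sens) => x y u v Tx Ty xu yv.
  apply: (argmin_dist_le_W1 (f := J1 Lfun L rho (Phat x))
    (g := J1 Lfun L rho (Phat y)) (X := Theta) (phi := loss1 Lfun)
    (r := fun x => rho * L * frob (col_mx x (const_mx 1 : 'cV[R]_1)) ^+ 2)
    cTheta beta0) => //; try exact: J1_strongly_subdiff.
  move=> z z' /(sP Tx) Zz /(sP Ty) Zz'.
  by apply: (smooth_loss_diff cTheta dl sl Zz Zz'); [case: xu|case: yv].
split=> // k1; apply: contraction_converges_to_unique_stable => //.
- move=> x Tx; apply: minimizer_exists c0 _ => //.
  exact: J1_strongly_subdiff.
- by move=> x u _ [].
- by rewrite mulr_ge0// divr_ge0// ltW.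
Qed.

End Model1.

(** * Compactness and subdivision *)

(** Covers transposition and the extraction of blocks. *)
Lemma mxreindex_continuous {R : realType} {m n p q}
    (f : 'M[R]_(m, n) -> 'M[R]_(p, q)) (r : 'I_p -> 'I_q -> 'I_m)
    (c : 'I_p -> 'I_q -> 'I_n) :
  (forall A i j, f A i j = A (r i j) (c i j)) -> continuous f.
Proof.
move=> fE A B /nbhs_ballP[e /= e0 eB].
apply/nbhs_ballP; exists e => //= A' [_ AA'].
by apply: eB; split=> // i j; rewrite !fE; exact: AA'.
Qed.

(** Transported by transposition from the case of row vectors. *)
Lemma bounded_closed_compact_cV {R : realType} {n} (A : set 'cV[R]_n) :
  bounded_set A -> closed A -> compact A.
Proof.
move=> bA cA.
have tr1 : continuous (@trmx R n 1).
  apply: (mxreindex_continuous (r := fun i j => j) (c := fun i j => i)).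
  by move=> B i j; rewrite mxE.
have tr2 : continuous (@trmx R 1 n).
  apply: (mxreindex_continuous (r := fun i j => j) (c := fun i j => i)).
  by move=> B i j; rewrite mxE.
have -> : A = trmx @` (trmx @^-1` A : set 'rV[R]_n).
  apply/seteqP; split=> [x Ax|_ [x Ax <-]//].
  by exists x^T => /=; rewrite trmxK.
apply: continuous_compact; first exact: continuous_subspaceT.
apply: bounded_closed_compact; last exact: (closed_comp (fun x _ => tr2 x)).
case: bA => M [Mr MA]; exists M; split=> // x Mx v /= /(MA x Mx).
apply: le_trans; rewrite [leLHS]/Num.norm/= mx_normrE.
apply/bigmax_leP; split=> [|ij _]; first exact: normr_ge0.
by have := coord_le_mx_norm v^T ij.2 ij.1; rewrite mxE.
Qed.

(** The superlevel sets of [h] at its own values generate a filter on [K]; by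
semicontinuity, [h] at a cluster point of it dominates every value. *)
Lemma usc_compact_max {R : realType} {T : topologicalType} (K : set T)
    (h : T -> R) :
  compact K -> K !=set0 ->
  (forall x c, K x -> h x < c -> \forall y \near x, K y -> h y < c) ->
  exists2 z, K z & forall y, K y -> h y <= h z.
Proof.
move=> cK [k0 Kk0] usc.
pose B y := [set x | K x /\ h y <= h x].
have FF : ProperFilter (filter_from K B).
  apply: filter_from_proper; last by move=> y Ky; exists y.
  apply: filter_from_filter; first by exists k0.
  move=> y1 y2 K1 K2; have [h12|h21] := leP (h y1) (h y2).
    by exists y2 => // x [Kx hx]; split; split=> //; exact: le_trans hx.
  exists y1 => // x [Kx hx]; split; split=> //.
  by apply: le_trans hx; exact: ltW.
have [|z [Kz clz]] := cK _ FF; first by exists k0 => // x [].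
exists z => // y Ky; rewrite leNgt; apply/negP => hzy.
have By : filter_from K B (B y) by exists y.
have [x [[Kx yx] /(_ Kx)]] := clz _ _ By (usc z _ Kz hzy).
by rewrite ltNge yx.
Qed.

Lemma frob_continuous {R : realType} {m n} : continuous (@frob R m n).
Proof.
move=> A; apply/(@cvgrPdist_lt _ _ _ (nbhs A) (nbhs_filter A)) => e e0.
have mn0 : (0 : R) < (m * n).+1%:R by [].
have := nbhsx_ballx A _ (divr_gt0 e0 mn0).
rewrite -ball_normE; apply: filterS => B /=; rewrite ltr_pdivlMr// => h.
have hAB : frob (A - B) < e.
  apply: le_lt_trans (frob_le_mx_norm _) _; apply: le_lt_trans h.
  by rewrite mulrC ler_wpM2l// ler_nat.
apply: le_lt_trans hAB; rewrite ler_norml lerNl opprB ler_frob_dist andbT.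
by rewrite (frobBC A) ler_frob_dist.
Qed.

(** Cutting [0, 1] into [n] equal parts divides the total second-order error by
[n]. This replaces differentiation where no derivative is at hand. *)
Lemma le_of_subdivision {R : realType} (phi : R -> R) (K C : R) :
  (forall s t, 0 <= s -> s <= t -> t <= 1 ->
     phi t - phi s <= K * (t - s) + C * (t - s) ^+ 2) ->
  phi 1 - phi 0 <= K.
Proof.
move=> h; apply/ler_addgt0Pr => e e0.
pose n := (Num.truncn (`|C| / e)).+1.
have n0 : (0 : R) < n%:R by [].
have Cn : C / n%:R <= e.
  rewrite ler_pdivrMr//; apply: le_trans (ler_norm C) _.
  by rewrite mulrC -ler_pdivrMr// ltW// /n truncnS_gt.
have step i : (i <= n)%N ->
    phi (i%:R / n%:R) - phi 0 <= i%:R * (K / n%:R + C / n%:R ^+ 2).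
  elim: i => [|i ih] ni; first by rewrite !mul0r subrr.
  have {ih} := ih (ltnW ni).
  have := h (i%:R / n%:R) (i.+1%:R / n%:R).
  rewrite -mulrBl -natrB// subSnn mul1r.
  have -> : 0 <= i%:R / n%:R :> R by rewrite divr_ge0.
  have -> : i%:R / n%:R <= i.+1%:R / n%:R :> R.
    by rewrite ler_pM2r ?invr_gt0// ler_nat.
  have -> : i.+1%:R / n%:R <= 1 :> R by rewrite ler_pdivrMr// mul1r ler_nat.
  by move=> /(_ erefl erefl erefl); rewrite exprVn -natr1; lra.
have := step n (leqnn n); rewrite divff ?gt_eqF// => /le_trans; apply.
rewrite (_ : _ * _ = K + C / n%:R) ?lerD2l//.
by field; rewrite gt_eqF.
Qed.

(** * Model 3: the worst-case scenario *)

Section Model3.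
Context {R : realType} {d m : nat}.
Variables (Theta : set 'cV[R]_d) (Z : set 'cV[R]_m)
  (loss : 'cV[R]_m -> 'cV[R]_d -> R) (gamma beta : R).
Hypotheses (Theta0 : Theta !=set0) (clTheta : closed Theta)
  (cTheta : convex_set Theta).
Hypotheses (Z0 : Z !=set0) (cZ : convex_set Z) (clZ : closed Z)
  (Zdiam : has_ubound (distances Z)).
Hypotheses (usc : usc_loss Z loss Theta) (conc : concave_loss Z loss Theta).
Hypotheses (dl : differentiable_loss Theta Z loss)
  (sc : strongly_convex Theta Z loss gamma)
  (sl : smooth Theta Z loss beta) (beta0 : 0 <= beta).

Lemma le_diam z z' : Z z -> Z z' -> frob (z - z') <= diam Z.
Proof. by move=> Zz Zz'; apply: ub_le_sup => //; exists z => //; exists z'. Qed.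

Lemma diam_ge0 : 0 <= diam Z.
Proof.
by have [z Zz] := Z0; apply: le_trans (le_diam Zz Zz); exact: frob_ge0.
Qed.

Lemma support_compact : compact Z.
Proof.
apply: bounded_closed_compact_cV => //; have [z0 Zz0] := Z0.
exists (frob z0 + diam Z); split; first exact: num_real.
move=> M ltM z Zz; apply: le_trans (mx_norm_le_frob z) _.
apply: le_trans (ltW ltM); rewrite -lerBlDl.
by apply: le_trans (ler_frob_dist _ _) _; exact: le_diam.
Qed.

Definition penalized (w : 'cV[R]_m) (u : 'cV[R]_d) (l : R) (z : 'cV[R]_m) : R :=
  loss z u - l * frob (z - w) ^+ 2.

Definition worst_case (w : 'cV[R]_m) (u : 'cV[R]_d) (l : R) : R :=
  sup [set penalized w u l z | z in Z].

Definition maximizer w u l z :=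
  Z z /\ forall y, Z y -> penalized w u l y <= penalized w u l z.

(** An upper semicontinuous function attains its maximum on the compact set
[Z]. The extended loss is -oo outside of [Z], so its semicontinuity is
information about the points of [Z] only. *)
Lemma maximizer_exists w u l : Theta u -> exists z, maximizer w u l z.
Proof.
move=> Tu.
have [x c Zx hx|z Zz hz] := @usc_compact_max _ _ Z (penalized w u l)
  support_compact Z0; last by exists z.
set e := c - penalized w u l x.
have e0 : 0 < e / 2 by rewrite divr_gt0// subr_gt0.
have ltloss : ((- (loss x u + e / 2))%:E < - ext_loss Z loss u x)%E.
  rewrite /ext_loss; case: ifPn => [_|]; last by rewrite notin_setE.
  by rewrite -EFinN lte_fin ltrN2 ltrDl.
have [V nV Vloss] := usc Tu ltloss.
have cont : (fun y => l * frob (y - w) ^+ 2) @ nbhs x --> l * frob (x - w) ^+ 2.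
  apply: (@cvg_comp _ _ _ (fun y => y - w) (fun v => l * frob v ^+ 2) _
    (nbhs (x - w))).
    apply: (@cvgB _ _ _ (nbhs x) (nbhs_filter x)); first exact: cvg_id.
    exact: cvg_cst.
  apply: (@cvg_comp _ _ _ frob (fun r => l * r ^+ 2) _ (nbhs (frob (x - w)))).
    exact: frob_continuous.
  by apply: cvgM; [exact: cvg_cst|exact: exprn_continuous].
have near_pen := (@cvgr_gt _ _ (nbhs x) (nbhs_filter x) _ _ cont
  (l * frob (x - w) ^+ 2 - e / 2)).
have := near_pen _; rewrite ltrBlDr ltrDl => /(_ e0).
move: nV; apply: filterS2 => y /Vloss + hy Zy.
rewrite /ext_loss; case: ifPn => [_|]; last by rewrite notin_setE.
rewrite -EFinN lte_fin ltrN2 => lossy.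
rewrite /penalized; move: hy lossy; rewrite /e /penalized; lra.
Qed.

Lemma worst_caseE w u l z : maximizer w u l z ->
  worst_case w u l = penalized w u l z.
Proof.
move=> [Zz zmax]; apply/eqP; rewrite eq_le; apply/andP; split.
  apply: ge_sup => [|_ [y Zy <-]]; last exact: zmax.
  by exists (penalized w u l z); exists z.
apply: ub_le_sup; last by exists z.
by exists (penalized w u l z) => _ [y Zy <-]; exact: zmax.
Qed.

Lemma le_worst_case w u l z : Theta u -> Z z ->
  penalized w u l z <= worst_case w u l.
Proof.
move=> Tu Zz; have [y ymax] := maximizer_exists w l Tu.
by rewrite (worst_caseE ymax) ymax.2.
Qed.

(** The loss is concave in [z] and the penalty adds the modulus [2 * l]. *)
Lemma maximizer_growth w u l z y : Theta u -> maximizer w u l z -> Z y ->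
  penalized w u l y + l * frob (y - z) ^+ 2 <= penalized w u l z.
Proof.
move=> Tu [Zz zmax] Zy.
have sN : strongly_convex_on (2 * l) Z (fun y => - penalized w u l y).
  move=> a b t Za Zb t0 t1.
  have := convex_function_segment (conc Tu) Za Zb t0 t1.
  rewrite /penalized !frob_sqr.
  have -> : a + t *: (b - a) - w = (1 - t) *: (a - w) + t *: (b - w).
    by apply/matrixP => i j; rewrite !mxE; ring.
  have -> : b - a = (b - w) - (a - w).
    by apply/matrixP => i j; rewrite !mxE; ring.
  move: (a - w) (b - w) => A B.
  rewrite !(dotDl, dotDr, dotNl, dotNr, dotZl, dotZr) (dotC B A); lra.
have mz : argmin Z (fun y => - penalized w u l y) z.
  by split=> // b Zb; rewrite lerN2 zmax.
have := minimizer_growth cZ sN mz Zy; lra.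
Qed.

(** Adding the growth inequalities at the two maximizers leaves the mixed
difference of the loss in [(z, u)], the inner product [<z1 - z2, w1 - w2>],
which makes the maximizer nonexpansive in the reference atom (it is a proximal
point), and a term proportional to [l2 - l1]. *)
Lemma maximizer_dist w1 w2 u1 u2 l1 l2 z1 z2 : Theta u1 -> Theta u2 ->
  0 < l1 -> l1 <= l2 -> maximizer w1 u1 l1 z1 -> maximizer w2 u2 l2 z2 ->
  Z w2 ->
  2 * l1 * frob (z1 - z2)
    <= 2 * l1 * frob (w1 - w2)
       + (2 * diam Z * (l2 - l1) + beta * frob (u1 - u2)).
Proof.
move=> T1 T2 l10 l12 m1 m2 Z2.
have [e|N0] := eqVneq (frob (z1 - z2)) 0.
  rewrite e mulr0 !addr_ge0 ?mulr_ge0 ?frob_ge0 ?diam_ge0 ?subr_ge0//.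
  exact: ltW.
have Np : 0 < frob (z1 - z2) by rewrite lt_neqAle eq_sym N0 frob_ge0.
rewrite -(ler_pM2r Np).
have g1 := maximizer_growth T1 m1 m2.1; have g2 := maximizer_growth T2 m2 m1.1.
have := smooth_loss_diff cTheta dl sl m1.1 m2.1 T2 T1.
have inner : frob (z1 - w1) ^+ 2 - frob (z2 - w1) ^+ 2 + frob (z2 - w2) ^+ 2
    - frob (z1 - w2) ^+ 2 = - 2 * dot (w1 - w2) (z1 - z2).
  rewrite !frob_sqr !(dotBl, dotBr).
  rewrite (dotC z1 w1) (dotC z1 w2) (dotC z2 w1) (dotC z2 w2).
  by rewrite !(dotC _ z1); ring.
have outer : frob (z1 - w2) ^+ 2 - frob (z2 - w2) ^+ 2
    <= 2 * diam Z * frob (z1 - z2).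
  have h1 := le_diam m1.1 Z2; have h2 := le_diam m2.1 Z2.
  have := ler_frob_dist (z1 - w2) (z2 - w2).
  rewrite opprB addrA subrK.
  have := frob_ge0 (z1 - w2); have := frob_ge0 (z2 - w2).
  rewrite subr_sqr; nra.
have := ler_wpM2l (ltW l10) (dot_le (w1 - w2) (z1 - z2)).
have l12' : 0 <= l2 - l1 by rewrite subr_ge0.
have {outer} := ler_wpM2l l12' outer.
move: g1 g2 inner; rewrite /penalized (frobBC z2 z1) (frobBC u2 u1).
have -> : 2 * l1 * frob (z1 - z2) * frob (z1 - z2)
    = 2 * l1 * frob (z1 - z2) ^+ 2.
  by rewrite expr2; ring.
have NN := mulr_ge0 l12' (sqr_ge0 (frob (z1 - z2))).
move: NN; set N := frob (z1 - z2).
set p11 := frob (z1 - w1) ^+ 2; set p12 := frob (z1 - w2) ^+ 2.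
set p21 := frob (z2 - w1) ^+ 2; set p22 := frob (z2 - w2) ^+ 2.
move=> NN g1 g2 inner.
have {inner} := congr1 ( *%R l1) inner.
nra.
Qed.

Lemma maximizer_dist_uniform w1 w2 u1 u2 l1 l2 l0 z1 z2 :
  Theta u1 -> Theta u2 -> Z w1 -> Z w2 -> 0 < l0 -> l0 <= l1 -> l0 <= l2 ->
  maximizer w1 u1 l1 z1 -> maximizer w2 u2 l2 z2 ->
  frob (z1 - z2) <= frob (w1 - w2)
    + (2 * diam Z * `|l1 - l2| + beta * frob (u1 - u2)) / (2 * l0).
Proof.
move=> T1 T2 Z1 Z2 l00 l01 l02 m1 m2.
rewrite -lerBlDl ler_pdivlMr ?mulr_gt0//.
have c0 : 0 <= 2 * diam Z * `|l1 - l2| + beta * frob (u1 - u2).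
  by rewrite addr_ge0 ?mulr_ge0 ?frob_ge0 ?diam_ge0.
have [Ne|/ltW eN] := leP (frob (z1 - z2)) (frob (w1 - w2)).
  by apply: le_trans c0; rewrite mulr_le0_ge0 ?subr_le0// mulr_ge0// ltW.
rewrite -subr_ge0 in eN.
have [l12|/ltW l21] := leP l1 l2.
  have := maximizer_dist T1 T2 (lt_le_trans l00 l01) l12 m1 m2 Z2.
  have -> : `|l1 - l2| = l2 - l1 by rewrite distrC ger0_norm// subr_ge0.
  have := ler_wpM2r eN l01; lra.
have := maximizer_dist T2 T1 (lt_le_trans l00 l02) l21 m2 m1 Z1.
rewrite (frobBC z2) (frobBC w2) (frobBC u2).
have -> : `|l1 - l2| = l1 - l2 by rewrite ger0_norm// subr_ge0.
have := ler_wpM2r eN l02; lra.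
Qed.

(** In each difference, keep the maximizer of the term counted positively: [z1]
for [(w1, u1, l1)] and [z2] for [(w2, u2, l2)]. They belong to different
decisions, which is why their distance exceeds [|w1 - w2|] by a first-order
amount and the bound carries a second-order error. The constant [4 * diam Z] is
[2 * diam Z], from the sum in a difference of squares, times 2, because [z - w]
moves by at most [|z1 - z2| + |w1 - w2|], which is twice [|w1 - w2|] up to that
error. *)
Lemma worst_case_diff_local w1 w2 u1 u2 l1 l2 l0 :
  Theta u1 -> Theta u2 -> Z w1 -> Z w2 -> 0 < l0 -> l0 <= l1 -> l0 <= l2 ->
  (worst_case w1 u1 l1 - worst_case w1 u2 l2)
  - (worst_case w2 u1 l1 - worst_case w2 u2 l2)
  <= (beta * frob (u1 - u2) + 4 * diam Z * `|l1 - l2|) * frob (w1 - w2)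
     + (beta * frob (u1 - u2) + 2 * diam Z * `|l1 - l2|) ^+ 2 / (2 * l0).
Proof.
move=> T1 T2 Z1 Z2 l00 l01 l02.
have [z1 m1] := maximizer_exists w1 l1 T1.
have [z2 m2] := maximizer_exists w2 l2 T2.
have N1 := maximizer_dist_uniform T1 T2 Z1 Z2 l00 l01 l02 m1 m2.
rewrite (worst_caseE m1) (worst_caseE m2).
have := le_worst_case w1 l2 T2 m1.1; have := le_worst_case w2 l1 T1 m2.1.
have := smooth_loss_diff cTheta dl sl m1.1 m2.1 T2 T1.
rewrite (frobBC u2); move: N1; set N := frob (z1 - z2).
set a := frob (u1 - u2); set e := frob (w1 - w2) => N1.
have N0 : 0 <= N := frob_ge0 _.
have a0 : 0 <= a := frob_ge0 _.
have e0 : 0 <= e := frob_ge0 _.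
have D0 := diam_ge0.
set b := `|l1 - l2| in N1 *; have b0 : 0 <= b := normr_ge0 _.
have quad : - ((l1 - l2) * (frob (z1 - w1) ^+ 2 - frob (z2 - w2) ^+ 2))
    <= b * (2 * diam Z * (N + e)).
  apply: le_trans (ler_norm _) _; rewrite normrN normrM ler_wpM2l//.
  rewrite subr_sqr normrM mulrC ler_pM//.
    have h1 := le_diam m1.1 Z1; have h2 := le_diam m2.1 Z2.
    by rewrite ger0_norm ?addr_ge0 ?frob_ge0//; lra.
  have h : frob ((z1 - w1) - (z2 - w2)) <= N + e.
    rewrite (_ : _ - _ = (z1 - z2) - (w1 - w2)) ?frobB//.
    by apply/matrixP => i j; rewrite !mxE; ring.
  apply: le_trans h; rewrite ler_norml lerNl opprB ler_frob_dist andbT.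
  by rewrite (frobBC (z1 - w1)) ler_frob_dist.
set q := beta * a + 2 * diam Z * b.
have q0 : 0 <= q by rewrite addr_ge0// !mulr_ge0.
have := ler_wpM2l q0 N1.
have -> : q * (e + (2 * diam Z * b + beta * a) / (2 * l0)) =
    q * e + q ^+ 2 / (2 * l0) by rewrite /q; ring.
move: quad; rewrite /penalized /q; lra.
Qed.

(** The local bound applied to the pieces of a fine subdivision of the segment
of decisions, on which the multiplier stays above [Num.min l1 l2 > 0]. *)
Lemma worst_case_diff_pos w1 w2 u1 u2 l1 l2 :
  Theta u1 -> Theta u2 -> Z w1 -> Z w2 -> 0 < l1 -> 0 < l2 ->
  (worst_case w1 u2 l2 - worst_case w1 u1 l1)
  - (worst_case w2 u2 l2 - worst_case w2 u1 l1)
  <= (beta * frob (u1 - u2) + 4 * diam Z * `|l1 - l2|) * frob (w1 - w2).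
Proof.
move=> T1 T2 Z1 Z2 l10 l20.
pose U (t : R) := u1 + t *: (u2 - u1); pose l (t : R) := l1 + t * (l2 - l1).
pose phi t := worst_case w1 (U t) (l t) - worst_case w2 (U t) (l t).
suff : phi 1 - phi 0
    <= (beta * frob (u1 - u2) + 4 * diam Z * `|l1 - l2|) * frob (w1 - w2).
  rewrite /phi /U /l !scale1r !scale0r !mul1r !mul0r !addr0.
  by rewrite [u1 + _]addrC subrK [l1 + _]addrC subrK; lra.
pose l0 := Num.min l1 l2.
have l00 : 0 < l0 by rewrite lt_min l10.
have ll t : 0 <= t -> t <= 1 -> l0 <= l t.
  move=> t0 t1; have h1 : l0 <= l1 by rewrite ge_min lexx.
  have h2 : l0 <= l2 by rewrite ge_min lexx orbT.
  by rewrite /l; nra.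
apply: (@le_of_subdivision _ _ _
  ((beta * frob (u1 - u2) + 2 * diam Z * `|l1 - l2|) ^+ 2 / (2 * l0))).
move=> s t s0 st t1.
have t0 := le_trans s0 st; have s1 := le_trans st t1.
have := worst_case_diff_local (convex_set_segment cTheta T1 T2 t0 t1)
  (convex_set_segment cTheta T1 T2 s0 s1) Z1 Z2 l00 (ll t t0 t1) (ll s s0 s1).
have ts0 : 0 <= t - s by rewrite subr_ge0.
have -> : U t - U s = (t - s) *: (u2 - u1).
  by apply/matrixP => i j; rewrite !mxE; ring.
rewrite frobZ (frobBC u2) (ger0_norm ts0).
have -> : l t - l s = (t - s) * - (l1 - l2) by rewrite /l; ring.
rewrite normrM normrN (ger0_norm ts0) /phi.
set A := frob _; set B := `|_|; set E := frob _.
have -> : (beta * ((t - s) * A) + 2 * diam Z * ((t - s) * B)) ^+ 2 / (2 * l0)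
  = (beta * A + 2 * diam Z * B) ^+ 2 / (2 * l0) * (t - s) ^+ 2 by ring.
lra.
Qed.

(** Used to leave the boundary [l = 0], where maximizers need not be unique. *)
Lemma worst_case_shift w u l e : Theta u -> Z w -> 0 <= e ->
  worst_case w u (l + e) <= worst_case w u l /\
  worst_case w u l <= worst_case w u (l + e) + e * diam Z ^+ 2.
Proof.
move=> Tu Zw e0; have [z mz] := maximizer_exists w l Tu.
have [z' mz'] := maximizer_exists w (l + e) Tu.
split.
  rewrite (worst_caseE mz'); apply: le_trans (le_worst_case w l Tu mz'.1).
  by rewrite /penalized lerD2l lerN2 mulrDl lerDl mulr_ge0 ?sqr_ge0.
rewrite (worst_caseE mz).
have := le_worst_case w (l + e) Tu mz.1; rewrite /penalized.
have : e * frob (z - w) ^+ 2 <= e * diam Z ^+ 2.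
  rewrite ler_wpM2l// ler_pXn2r ?nnegrE ?frob_ge0 ?diam_ge0//.
  by apply: le_diam => //; exact: mz.1.
lra.
Qed.

Lemma worst_case_diff w1 w2 u1 u2 l1 l2 :
  Theta u1 -> Theta u2 -> Z w1 -> Z w2 -> 0 <= l1 -> 0 <= l2 ->
  (worst_case w1 u2 l2 - worst_case w1 u1 l1)
  - (worst_case w2 u2 l2 - worst_case w2 u1 l1)
  <= (beta * frob (u1 - u2) + 4 * diam Z * `|l1 - l2|) * frob (w1 - w2).
Proof.
move=> T1 T2 Z1 Z2 l10 l20; apply/ler_addgt0Pr => e e0.
have D2 : 0 < 2 * diam Z ^+ 2 + 1 by rewrite ltr_wpDl// mulr_ge0// sqr_ge0.
(* raising both multipliers by [s] costs at most [2 * s * diam Z ^+ 2 <= e] *)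
pose s := e / (2 * diam Z ^+ 2 + 1).
have s0 : 0 < s by rewrite divr_gt0.
have sE : s * (2 * diam Z ^+ 2 + 1) = e by rewrite divfK// gt_eqF.
have := worst_case_diff_pos T1 T2 Z1 Z2 (ltr_wpDl l10 s0) (ltr_wpDl l20 s0).
have -> : l1 + s - (l2 + s) = l1 - l2 by ring.
have [] := worst_case_shift l2 T2 Z1 (ltW s0).
have [] := worst_case_shift l1 T1 Z1 (ltW s0).
have [] := worst_case_shift l2 T2 Z2 (ltW s0).
have [] := worst_case_shift l1 T1 Z2 (ltW s0).
move: sE s0; clearbody s; lra.
Qed.

End Model3.

(** * Model 3: the regularized problem in (theta, lambda) *)

Definition multiplier {R : realType} {d} (x : 'cV[R]_(d + 1)) : R :=
  dsubmx x 0 0.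

(** A decision and its multiplier as one vector, so that strong convexity and
minimization are those of column vectors. *)
Definition stack {R : realType} {d} (u : 'cV[R]_d) (l : R) : 'cV[R]_(d + 1) :=
  col_mx u (const_mx l).

Lemma usubmx_stack {R : realType} {d} (u : 'cV[R]_d) (l : R) :
  usubmx (stack u l) = u.
Proof. exact: col_mxKu. Qed.

Lemma multiplier_stack {R : realType} {d} (u : 'cV[R]_d) (l : R) :
  multiplier (stack u l) = l.
Proof. by rewrite /multiplier col_mxKd mxE. Qed.

Lemma usubmxB {R : realType} {d} (x y : 'cV[R]_(d + 1)) :
  usubmx (x - y) = usubmx x - usubmx y.
Proof. by apply/matrixP => i j; rewrite !mxE. Qed.

Lemma multiplierB {R : realType} {d} (x y : 'cV[R]_(d + 1)) :
  multiplier (x - y) = multiplier x - multiplier y.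
Proof. by rewrite /multiplier !mxE. Qed.

Lemma dot_stack {R : realType} {d} (u : 'cV[R]_d) (l : R) x :
  dot (stack u l) x = dot u (usubmx x) + l * multiplier x.
Proof.
rewrite -[x in LHS]vsubmxK dot_col_mx; congr (_ + _).
by rewrite /dot !big_ord1 mxE.
Qed.

Lemma stackK {R : realType} {d} (x : 'cV[R]_(d + 1)) :
  stack (usubmx x) (multiplier x) = x.
Proof.
rewrite -[RHS]vsubmxK; congr col_mx.
by apply/matrixP => i j; rewrite mxE !ord1.
Qed.

Lemma frob_stack_sqr {R : realType} {d} (x : 'cV[R]_(d + 1)) :
  frob x ^+ 2 = frob (usubmx x) ^+ 2 + multiplier x ^+ 2.
Proof. by rewrite frob_sqr -{1}[x]stackK dot_stack frob_sqr expr2. Qed.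

Lemma frob_usubmx_le {R : realType} {d} (x : 'cV[R]_(d + 1)) :
  frob (usubmx x) <= frob x.
Proof.
by rewrite -(@ler_pXn2r _ 2) ?nnegrE ?frob_ge0// frob_stack_sqr lerDl sqr_ge0.
Qed.

Lemma normr_multiplier_le {R : realType} {d} (x : 'cV[R]_(d + 1)) :
  `|multiplier x| <= frob x.
Proof.
rewrite -(@ler_pXn2r _ 2) ?nnegrE ?frob_ge0// frob_stack_sqr.
by rewrite real_normK ?num_real// lerDr sqr_ge0.
Qed.

Section Model3Contraction.
Context {R : realType} {d m S : nat}.
Variables (Theta : set 'cV[R]_d) (eps rho : R) (Z : set 'cV[R]_m)
  (Phat : 'cV[R]_d -> refdist R S 'cV[R]_m)
  (loss : 'cV[R]_m -> 'cV[R]_d -> R) (tau gamma beta : R).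
Hypotheses (Theta0 : Theta !=set0) (clTheta : closed Theta)
  (cTheta : convex_set Theta).
Hypotheses (eps0 : 0 <= eps) (tau0 : 0 < tau) (gamma0 : 0 < gamma)
  (beta0 : 0 <= beta).
Hypotheses (Z0 : Z !=set0) (cZ : convex_set Z) (clZ : closed Z)
  (Zdiam : has_ubound (distances Z)) (sP : supported_in Theta Phat Z).
Hypotheses (usc : usc_loss Z loss Theta) (conc : concave_loss Z loss Theta).
Hypotheses (dl : differentiable_loss Theta Z loss)
  (sc : strongly_convex Theta Z loss gamma)
  (sl : smooth Theta Z loss beta) (sens : sensitive Theta Phat eps).

Let X : set 'cV[R]_(d + 1) :=
  [set x | Theta (usubmx x) /\ 0 <= multiplier x].

Let phi (w : 'cV[R]_m) (x : 'cV[R]_(d + 1)) : R :=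
  worst_case Z loss w (usubmx x) (multiplier x).

Let reg (x : 'cV[R]_(d + 1)) : R :=
  rho ^+ 2 * multiplier x + tau * multiplier x ^+ 2.

Let J (P : refdist R S 'cV[R]_m) (x : 'cV[R]_(d + 1)) : R :=
  J3 Z loss rho tau P (usubmx x, multiplier x).

Let c : R := Num.min (2 * tau) gamma.

Let c_gt0 : 0 < c. Proof. by rewrite lt_min mulr_gt0. Qed.

Let JE (P : refdist R S 'cV[R]_m) x :
  J P x = \sum_s prob P s * phi (atom P s) x + reg x.
Proof. by rewrite /J /J3 /reg addrA. Qed.

Let stackX u l : Theta u -> 0 <= l -> X (stack u l).
Proof. by move=> Tu l0; rewrite /X /= usubmx_stack multiplier_stack. Qed.

Let convX : convex_set X.
Proof.
apply: segment_convex_set => x y t [Tx lx] [Ty ly] t0 t1; split.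
  have -> : usubmx (x + t *: (y - x)) = usubmx x + t *: (usubmx y - usubmx x).
    by apply/matrixP => i j; rewrite !mxE.
  exact: convex_set_segment.
have -> : multiplier (x + t *: (y - x))
    = (1 - t) * multiplier x + t * multiplier y.
  by rewrite /multiplier !mxE; ring.
by rewrite addr_ge0// mulr_ge0// subr_ge0.
Qed.

Let closedX : closed X.
Proof.
apply: closedI.
  have uc : continuous (@usubmx R d 1 1).
    apply: (mxreindex_continuous (r := fun i _ => lshift 1 i)
      (c := fun _ j => j)).
    by move=> A i j; rewrite mxE.
  exact: (closed_comp (fun x _ => uc x)).
have lc : continuous (fun x : 'cV[R]_(d + 1) => x (rshift d 0) 0).
  exact: coord_continuous.
have -> : (fun x => is_true (0 <= multiplier x)) =
    (fun x : 'cV[R]_(d + 1) => x (rshift d 0) 0) @^-1` [set l : R | 0 <= l].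
  by apply/funext => x; rewrite /multiplier mxE.
by apply: (closed_comp (fun x _ => lc x)); exact: closed_ge.
Qed.

Let X0 : X !=set0.
Proof. by have [u Tu] := Theta0; exists (stack u 0); exact: stackX. Qed.

(** A minorant at [x] comes from the scenario that is worst at [x]: it is
[gamma]-strongly convex in theta and affine in lambda, with slope [- |z -
w|^2], and [tau * lambda^2] supplies the curvature in lambda. *)
Lemma phi_reg_strongly_subdiff w :
  strongly_subdiff c X (fun x => phi w x + reg x).
Proof.
move=> x [Tx lx].
have [z mz] := maximizer_exists Z0 clZ Zdiam usc w (multiplier x) Tx.
exists (stack (grad (loss z) (usubmx x))
  (rho ^+ 2 + 2 * tau * multiplier x - frob (z - w) ^+ 2)) => y [Ty ly].
rewrite /phi (worst_caseE mz).
have := le_worst_case Z0 clZ Zdiam usc w (multiplier y) Ty mz.1.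
have := sc mz.1 Ty Tx; rewrite mul_tr_dot.
rewrite dot_stack frob_stack_sqr usubmxB multiplierB /reg /penalized.
set N := frob (usubmx y - usubmx x); set D := dot _ _.
set a := multiplier x; set b := multiplier y.
have c1 : c <= 2 * tau by rewrite ge_min lexx.
have c2 : c <= gamma by rewrite ge_min lexx orbT.
have := ler_wpM2r (sqr_ge0 N) c2; have := ler_wpM2r (sqr_ge0 (b - a)) c1.
clearbody c; lra.
Qed.

Let J_strongly_subdiff P : strongly_subdiff c X (J P).
Proof.
have -> : J P = fun x => \sum_s prob P s * (phi (atom P s) x + reg x).
  apply/funext => x; rewrite JE.
  under [RHS]eq_bigr do rewrite mulrDr.
  by rewrite big_split/= -mulr_suml prob_sum1 mul1r.
apply: strongly_subdiff_sum; [exact: prob_ge0|exact: prob_sum1|].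
by move=> s _; exact: phi_reg_strongly_subdiff.
Qed.

Let argmin_stack P u l :
  argmin (Theta `*` [set l : R | 0 <= l]) (J3 Z loss rho tau P) (u, l) ->
  argmin X (J P) (stack u l).
Proof.
move=> [[/= Tu l0] umin]; split; first exact: stackX.
by move=> y [Ty ly]; rewrite /J usubmx_stack multiplier_stack; exact: umin.
Qed.

Lemma model3_contraction :
  let k := eps * ((beta + 4 * diam Z) / c) in
  step_lipschitz Theta (next3 Z loss Theta rho tau Phat) k /\
  (k < 1 ->
   converges_to_unique_stable Theta (next3 Z loss Theta rho tau Phat) k).
Proof.
move=> k; have D0 := diam_ge0 Z0 Zdiam.
have K0 : 0 <= beta + 4 * diam Z by rewrite addr_ge0// mulr_ge0.
have step : step_lipschitz Theta (next3 Z loss Theta rho tau Phat) k.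
  apply: (step_lipschitz_argmin c_gt0 K0 sens) => x y u v Tx Ty [l ul] [l' vl'].
  have mu := argmin_stack ul; have mv := argmin_stack vl'.
  (* the contraction holds for the pairs, whose theta components are closer *)
  apply: le_trans (_ : c * frob (stack u l - stack v l') <= _).
    rewrite ler_wpM2l ?(ltW c_gt0)//.
    have := frob_usubmx_le (stack u l - stack v l').
    by rewrite usubmxB !usubmx_stack.
  apply: (argmin_dist_le_W1 convX K0 (JE _) (JE _) (J_strongly_subdiff _)
    (J_strongly_subdiff _) mu mv) => z z' /(sP Tx) Zz /(sP Ty) Zz'.
  have [[Tu lu] [Tv lv]] := (mu.1, mv.1).
  apply: le_trans (worst_case_diff cTheta Z0 cZ clZ Zdiam usc conc dl sl beta0
    Tu Tv Zz Zz' lu lv) _.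
  apply: ler_wpM2r; first exact: frob_ge0.
  rewrite [leRHS]mulrDl; apply: lerD.
    by rewrite ler_wpM2l// -usubmxB; exact: frob_usubmx_le.
  by rewrite ler_wpM2l ?mulr_ge0// -multiplierB; exact: normr_multiplier_le.
split=> // k1; apply: contraction_converges_to_unique_stable => //.
- move=> x Tx.
  have [y [[Ty ly] ymin]] :=
    minimizer_exists X0 closedX convX c_gt0 (J_strongly_subdiff (Phat x)).
  exists (usubmx y), (multiplier y); split=> // -[u l] [/= Tu l0].
  by have := ymin _ (stackX Tu l0); rewrite /J usubmx_stack multiplier_stack.
- by move=> x u _ [l [[]]].
- by rewrite mulr_ge0// divr_ge0// ltW.
Qed.

End Model3Contraction.

(** * Least eigenvalue *)

Lemma dot_mulmxr {R : realType} {m n} (A : 'M[R]_(m, n)) (x : 'cV[R]_m)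
    (y : 'cV[R]_n) : dot x (A *m y) = dot (A^T *m x) y.
Proof. by rewrite -!mul_tr_dot trmx_mul trmxK mulmxA. Qed.

Lemma frob_trmx {R : realType} {m n} (A : 'M[R]_(m, n)) : frob A^T = frob A.
Proof.
rewrite /frob exchange_big; congr Num.sqrt; apply: eq_bigr => i _.
by apply: eq_bigr => j _; rewrite mxE.
Qed.

Lemma frob_mulmx {R : realType} {m n p} (A : 'M[R]_(m, n)) (B : 'M[R]_(n, p)) :
  frob (A *m B) <= frob A * frob B.
Proof.
apply: frob_le; first by rewrite mulr_ge0 ?frob_ge0.
rewrite exprMn !frob_sqr [X in _ * X]exchange_big mulr_suml.
apply: ler_sum => i _; rewrite mulr_sumr; apply: ler_sum => j _.
have -> : (A *m B) i j = dot (row i A)^T (col j B).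
  by rewrite mxE; apply: eq_bigr => k _; rewrite big_ord1 !mxE.
have -> : \sum_k A i k * A i k = frob (row i A)^T ^+ 2.
  by rewrite frob_sqr; apply: eq_bigr => k _; rewrite big_ord1 !mxE.
have -> : \sum_k B k j * B k j = frob (col j B) ^+ 2.
  by rewrite frob_sqr; apply: eq_bigr => k _; rewrite big_ord1 !mxE.
rewrite -expr2 -exprMn -[leLHS]real_normK ?num_real//.
by rewrite ler_pXn2r ?nnegrE ?normr_ge0 ?mulr_ge0 ?frob_ge0// normr_dot_le.
Qed.

Section LeastEigenvalue.
Context {R : realType} {n : nat}.
Implicit Types (B C : 'M[R]_n) (x : 'cV[R]_n).

Definition psd C := forall x, 0 <= dot x (C *m x).

(** Evaluate the form at [x - K^-1 C^-1 x], with [K] above the norm of [C^-1]: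
its value is [<x, C x> - 2 K^-1 |x|^2 + K^-2 <C^-1 x, x>], and the last term is
at most [K^-1 |x|^2]. *)
Lemma psd_unit_coercive C : C^T = C -> psd C -> C \in unitmx ->
  exists2 e : R, 0 < e & forall x, e * dot x x <= dot x (C *m x).
Proof.
move=> Csym Cpsd Cu; pose K := frob (invmx C) + 1.
have K0 : 0 < K by rewrite ltr_wpDl ?frob_ge0.
exists K^-1; first by rewrite invr_gt0.
move=> x; pose y := invmx C *m x.
have Cy : C *m y = x by rewrite /y mulKVmx.
have := Cpsd (x - K^-1 *: y).
rewrite mulmxBr -scalemxAr Cy !(dotBl, dotBr, dotZl, dotZr).
have -> : dot y (C *m x) = dot x x by rewrite dot_mulmxr Csym Cy.
have yx : dot y x <= K * dot x x.
  apply: le_trans (dot_le _ _) _.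
  rewrite -frob_sqr expr2 mulrA ler_wpM2r ?frob_ge0//.
  apply: le_trans (frob_mulmx _ _) _.
  by rewrite ler_wpM2r ?frob_ge0// lerDl.
have Ki : 0 <= K^-1 by rewrite invr_ge0 ltW.
have := ler_wpM2l Ki (ler_wpM2l Ki yx).
rewrite !mulrA -[_ / _ * K]mulrA mulVf ?gt_eqF//.
lra.
Qed.

Lemma rayleigh_eigenvalue B (a : R) : B^T = B -> eigenvalue B a ->
  exists2 x : 'cV[R]_n, x != 0 & B *m x = a *: x.
Proof.
move=> Bsym /eigenvalueP[v vB v0]; exists v^T; first by rewrite trmx_eq0.
by rewrite -[B in LHS]Bsym -trmx_mul vB linearZ.
Qed.

(** The largest [t0] for which [B - t0 I] is still positive semidefinite is an
eigenvalue: otherwise [B - t0 I] would be invertible, hence coercive, and [t0]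
could be increased. *)
Lemma lambda_minP B : (0 < n)%N -> B^T = B -> psd B ->
  eigenvalue B (lambda_min B) /\
  forall x, lambda_min B * dot x x <= dot x (B *m x).
Proof.
move=> n0 Bsym Bpsd.
pose T := [set t : R | forall x, t * dot x x <= dot x (B *m x)].
have dot_gt0 x : x != 0 -> 0 < dot x x.
  move=> x0; rewrite lt_neqAle dot_ge0 andbT eq_sym; apply: contra x0.
  by rewrite -frob_sqr sqrf_eq0 => /eqP/frob_eq0 ->.
have T0 : T 0 by move=> x; rewrite mul0r.
pose e0 : 'cV[R]_n := delta_mx (Ordinal n0) 0.
have e00 : e0 != 0.
  apply/eqP => /matrixP/(_ (Ordinal n0) 0)/eqP.
  by rewrite !mxE !eqxx oner_eq0.
have ubT : ubound T (dot e0 (B *m e0) / dot e0 e0).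
  by move=> t Tt; rewrite ler_pdivlMr ?dot_gt0.
have supT : has_sup T by split; [exists 0|eexists; exact: ubT].
pose t0 := sup T.
have Tt0 : T t0.
  move=> x; have [->|x0] := eqVneq x 0; first by rewrite !dot0l mulr0.
  rewrite -ler_pdivlMr ?dot_gt0//; apply: ge_sup; first by exists 0.
  by move=> t Tt; rewrite ler_pdivlMr ?dot_gt0.
have eig : eigenvalue B t0.
  rewrite /eigenvalue /eigenspace kermx_eq0 row_free_unit; apply/negP => Cu.
  have Cx x : dot x ((B - t0%:M) *m x) = dot x (B *m x) - t0 * dot x x.
    by rewrite mulmxBl mul_scalar_mx dotBr dotZr.
  have [||e e_gt0 eC] := psd_unit_coercive _ _ Cu.
  - by rewrite linearB/= Bsym tr_scalar_mx.
  - by move=> x; rewrite Cx subr_ge0; exact: Tt0.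
  have : T (t0 + e) by move=> x; have := eC x; rewrite Cx; lra.
  move=> /(ub_le_sup supT.2); rewrite -/t0; lra.
have -> : lambda_min B = t0; last by split.
apply/eqP; rewrite eq_le; apply/andP; split.
  apply: ge_inf; last exact: eig.
  exists t0 => a /(rayleigh_eigenvalue Bsym)[x x0 Bx].
  by have := Tt0 x; rewrite Bx dotZr ler_pM2r ?dot_gt0.
apply: lb_le_inf; first by exists t0.
move=> a /(rayleigh_eigenvalue Bsym)[x x0 Bx].
by have := Tt0 x; rewrite Bx dotZr ler_pM2r ?dot_gt0.
Qed.

Lemma lambda_min_gt0 B : (0 < n)%N -> B^T = B -> posdef B -> 0 < lambda_min B.
Proof.
move=> n0 Bsym Bpos.
have BposE x : x != 0 -> 0 < dot x (B *m x).
  by move=> /Bpos; rewrite -mulmxA mul_tr_dot.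
have Bpsd : psd B.
  by move=> x; have [->|/BposE/ltW//] := eqVneq x 0; rewrite dot0l.
have [/(rayleigh_eigenvalue Bsym)[x x0 Bx] _] := lambda_minP n0 Bsym Bpsd.
by have := BposE x x0; rewrite Bx dotZr pmulr_lgt0// -frob_sqr exprn_gt0//
  lt_neqAle frob_ge0 andbT eq_sym; apply: contra x0 => /eqP/frob_eq0 ->.
Qed.

End LeastEigenvalue.

Lemma alpha2P {R : realType} {J N d : nat} (M : affine_pieces R J N d) :
  (0 < J)%N -> (0 < d)%N ->
  (forall j, posdef ((Abar M j)^T *m Abar M j)) ->
  0 < alpha2 M /\
  forall j (v : 'cV[R]_d),
    alpha2 M / 2 * frob v ^+ 2 <= frob (Abar M j *m v) ^+ 2.
Proof.
move=> J0 d0 pd; pose B j := (Abar M j)^T *m Abar M j.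
have Bsym j : (B j)^T = B j by rewrite /B trmx_mul trmxK.
have qB j (v : 'cV[R]_d) : dot v (B j *m v) = frob (Abar M j *m v) ^+ 2.
  by rewrite frob_sqr dot_mulmxr trmx_mul trmxK /B dot_mulmxr mulmxA.
have lam0 j : 0 < lambda_min (B j).
  by apply: (lambda_min_gt0 d0 (Bsym j)); exact: pd.
pose j0 := Ordinal J0.
case: (@arg_minP _ _ _ j0 xpredT (fun j => lambda_min (B j)) isT) => i _ imin.
split.
  rewrite /alpha2 mulr_gt0//; apply: lt_le_trans (lam0 i) _.
  apply: lb_le_inf; first by exists (lambda_min (B i)); exists i.
  by move=> _ [j _ <-]; exact: imin.
move=> j v; rewrite /alpha2 [2 * _]mulrC mulfK// -qB.
apply: le_trans (_ : lambda_min (B j) * frob v ^+ 2 <= _).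
  rewrite ler_wpM2r ?sqr_ge0//; apply: ge_inf; last by exists j.
  by exists (lambda_min (B i)) => _ [l _ <-]; exact: imin.
rewrite frob_sqr; apply: (lambda_minP d0 (Bsym j) _).2.
by move=> x; rewrite qB sqr_ge0.
Qed.

(** * Smoothed maximum *)

Section LogSumExp.
Context {R : realType} {J : nat}.
Variable mu : R.
Hypotheses (J0 : (0 < J)%N) (mu0 : 0 < mu).
Implicit Types (a b v w : 'I_J -> R).

Definition lse v : R := mu * ln (\sum_j expR (v j / mu)).

(** The gradient of [lse]. Writing the weights as exponentials of affine
functions of [v j] and [lse v] makes their derivative immediate from that of
[lse]. *)
Definition softmax v j : R := expR ((v j - lse v) / mu).

Let sum_gt0 v : 0 < \sum_j expR (v j / mu).
Proof.
rewrite (bigD1 (Ordinal J0))//= ltr_pwDl ?expR_gt0//.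
by apply: sumr_ge0 => *; exact: expR_ge0.
Qed.

Let mu_neq0 : mu != 0. Proof. by rewrite gt_eqF. Qed.

Lemma softmax_gt0 v j : 0 < softmax v j. Proof. exact: expR_gt0. Qed.

Lemma softmaxE v j : softmax v j = expR (v j / mu) / \sum_k expR (v k / mu).
Proof.
by rewrite /softmax mulrBl expRD expRN /lse [mu * _]mulrC mulfK// lnK ?posrE.
Qed.

Lemma softmax_sum1 v : \sum_j softmax v j = 1.
Proof.
under eq_bigr do rewrite softmaxE.
by rewrite -mulr_suml divff// gt_eqF.
Qed.

(** Convexity of [lse], that is, Jensen's inequality for the exponential under
the softmax weights; it comes from the tangent to [expR] at the mean of the
increments. *)
Lemma lse_tangent v w : lse w + \sum_j softmax w j * (v j - w j) <= lse v.
Proof.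
set m := \sum_j _.
have S0 := sum_gt0 w.
have step : (\sum_j expR (w j / mu)) * expR (m / mu) <= \sum_j expR (v j / mu).
  have -> : \sum_j expR (v j / mu) = (\sum_j expR (w j / mu)) *
      \sum_j softmax w j * expR ((v j - w j) / mu).
    rewrite mulr_sumr; apply: eq_bigr => j _; rewrite softmaxE mulrA mulrCA.
    rewrite divff ?gt_eqF// mulr1 -expRD; congr expR.
    by rewrite mulrBl addrC subrK.
  rewrite ler_pM2l//.
  apply: (@le_trans _ _ (\sum_j softmax w j *
      (expR (m / mu) * (1 + ((v j - w j) / mu - m / mu))))).
    have -> : \sum_j softmax w j *
          (expR (m / mu) * (1 + ((v j - w j) / mu - m / mu)))
       = expR (m / mu) * (\sum_j (softmax w j * (1 - m / mu)
            + softmax w j * (v j - w j) / mu)).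
      by rewrite mulr_sumr; apply: eq_bigr => j _; ring.
    rewrite big_split/= -!mulr_suml softmax_sum1 -/m mul1r subrK mulr1//.
  apply: ler_sum => j _; rewrite ler_wpM2l ?(ltW (softmax_gt0 _ _))//.
  rewrite -[in leRHS](subrK (m / mu) ((v j - w j) / mu)) expRD mulrC.
  by rewrite ler_wpM2r ?expR_ge0// expR_ge1Dx.
have SE0 := mulr_gt0 S0 (expR_gt0 (m / mu)).
rewrite -(ler_ln SE0 (sum_gt0 v)) lnM ?posrE ?expR_gt0// expRK in step.
apply: le_trans (ler_wpM2l (ltW mu0) step).
by rewrite mulrDr [X in _ <= _ + X]mulrC divfK.
Qed.

(** [lse] is nondecreasing and commutes with adding a constant to all entries,
so a common quadratic term in the minorants of the pieces survives. *)
Lemma strongly_subdiff_lse {n} (m : R) (X : set 'cV[R]_n)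
    (f : 'I_J -> 'cV[R]_n -> R) :
  (forall j, strongly_subdiff m X (f j)) ->
  strongly_subdiff m X (fun x => lse (f ^~ x)).
Proof.
move=> sf x Xx.
have /choice[g gP] : forall j, exists g, forall y, X y ->
    f j x + dot g (y - x) + m / 2 * frob (y - x) ^+ 2 <= f j y.
  by move=> j; exact: sf.
exists (\sum_j softmax (f ^~ x) j *: g j) => y Xy.
apply: le_trans (lse_tangent (f ^~ y) (f ^~ x)).
rewrite -addrA lerD2l dot_suml -[m / 2 * _]mul1r.
set q := m / 2 * _; rewrite -(softmax_sum1 (f ^~ x)) mulr_suml -big_split/=.
apply: ler_sum => j _; rewrite dotZl -mulrDr.
rewrite ler_wpM2l ?(ltW (softmax_gt0 _ _))//.
by have := gP j y Xy; rewrite -/q; lra.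
Qed.

Lemma is_derive_lse (f : 'I_J -> R -> R) (df : 'I_J -> R) (t : R) :
  (forall j, is_derive t 1 (f j) (df j)) ->
  is_derive t 1 (fun s => lse (f ^~ s))
    (\sum_j softmax (f ^~ t) j * df j).
Proof.
move=> fdf.
have h1 j : is_derive t 1 (fun s => expR (f j s / mu))
    (expR (f j t / mu) * (df j / mu)).
  apply: (@is_derive1_comp _ expR (fun s => f j s / mu)).
  have -> : (fun s => f j s / mu) = (mu^-1 *: f j).
    by apply/funext => s; rewrite /= mulrC.
  by apply: is_derive_eq; rewrite [LHS]mulrC.
have h2 : is_derive t 1 (fun s => \sum_j expR (f j s / mu))
    (\sum_j expR (f j t / mu) * (df j / mu)).
  have -> : (fun s => \sum_j expR (f j s / mu))
      = \sum_j (fun s => expR (f j s / mu)).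
    by apply/funext => s; rewrite fct_sumE.
  exact: is_derive_sum.
have h3 := @is_derive1_comp _ (@ln R) _ _ _ _
  (is_derive1_ln (sum_gt0 (f ^~ t))) h2.
have -> : (fun s => lse (f ^~ s))
    = mu *: (@ln R \o (fun s => \sum_j expR (f j s / mu))).
  by apply/funext => s.
apply: is_derive_eq; rewrite mulr_sumr [LHS]mulr_sumr; apply: eq_bigr => j _.
by rewrite softmaxE; field; rewrite mu_neq0 gt_eqF.
Qed.

(** The covariance structure of the Hessian of [lse]. *)
Lemma is_derive_softmax (f : 'I_J -> R -> R) (df : 'I_J -> R) (t : R) j :
  (forall j, is_derive t 1 (f j) (df j)) ->
  is_derive t 1 (fun s => softmax (f ^~ s) j)
    (softmax (f ^~ t) j * ((df j - \sum_k softmax (f ^~ t) k * df k) / mu)).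
Proof.
move=> fdf; have lder := is_derive_lse fdf; have fj := fdf j.
apply: (@is_derive1_comp _ expR (fun s => (f j s - lse (f ^~ s)) / mu)).
have -> : (fun s => (f j s - lse (f ^~ s)) / mu)
    = mu^-1 *: (f j - (fun s => lse (f ^~ s))).
  by apply/funext => s; rewrite [LHS]mulrC.
by apply: is_derive_eq; rewrite [LHS]mulrC.
Qed.

(** Each term is at most [A * B]: the deviation of [a j] from the mean is at
most [2 (1 - p) A], where [p] is the weight of [j], and [2 p (1 - p) <= 1]. *)
Lemma softmax_cov_le v a b (A B : R) :
  (forall j, `|a j| <= A) -> (forall j, `|b j| <= B) ->
  \sum_j softmax v j * (a j - \sum_k softmax v k * a k) * b j <= J%:R * (A * B).
Proof.
move=> aA bB.
have A0 : 0 <= A by apply: le_trans (aA (Ordinal J0)).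
have B0 : 0 <= B by apply: le_trans (bB (Ordinal J0)).
have -> : J%:R * (A * B) = \sum_(j < J) A * B.
  by rewrite sumr_const card_ord mulr_natl.
apply: ler_sum => j _; apply: le_trans (ler_norm _) _; rewrite normrM.
rewrite ler_pM// normrM (gtr0_norm (softmax_gt0 _ _)).
have wj := softmax_gt0 v j.
have rest : \sum_(k | k != j) softmax v k = 1 - softmax v j.
  by rewrite -(softmax_sum1 v) [X in _ = X - _](bigD1 j)//= addrAC subrr add0r.
have rest_ge0 : 0 <= 1 - softmax v j.
  by rewrite -rest; apply: sumr_ge0 => k _; exact: ltW (softmax_gt0 _ _).
rewrite (bigD1 j)//=; set s := \sum_(k | _) _.
have sA : `|s| <= (1 - softmax v j) * A.
  apply: le_trans (ler_norm_sum _ _ _) _; rewrite -rest mulr_suml.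
  apply: ler_sum => k _; rewrite normrM (gtr0_norm (softmax_gt0 _ _)).
  by rewrite ler_wpM2l ?(ltW (softmax_gt0 _ _)).
have -> : a j - (softmax v j * a j + s) = (1 - softmax v j) * a j - s by ring.
have h : `|(1 - softmax v j) * a j - s| <= 2 * (1 - softmax v j) * A.
  apply: le_trans (ler_normB _ _) _; rewrite normrM (ger0_norm rest_ge0).
  have := ler_wpM2l rest_ge0 (aA j); lra.
apply: le_trans (ler_wpM2l (ltW wj) h) _.
set p := softmax v j; have := mulr_ge0 A0 (sqr_ge0 (p - 2^-1)); nra.
Qed.

End LogSumExp.

(** * Model 2: the matrices Gammaj *)

Lemma dot_outer {R : realType} {m n} (Y : 'M[R]_(m, n)) (x : 'cV[R]_m)
    (y : 'cV[R]_n) : dot Y (x *m y^T) = dot x (Y *m y).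
Proof.
apply: eq_bigr => i _; rewrite big_ord1 mxE mulr_sumr; apply: eq_bigr => j _.
by rewrite !mxE big_ord1 mxE; ring.
Qed.

Lemma dot_block_mx {R : realType} {m1 m2 n1 n2} (A A' : 'M[R]_(m1, n1))
    (B B' : 'M[R]_(m1, n2)) (C C' : 'M[R]_(m2, n1)) (D D' : 'M[R]_(m2, n2)) :
  dot (block_mx A B C D) (block_mx A' B' C' D')
  = dot A A' + dot B B' + (dot C C' + dot D D').
Proof.
rewrite /dot big_split_ord/=; congr (_ + _); rewrite -big_split/=;
  apply: eq_bigr => i _; rewrite big_split_ord/=; congr (_ + _);
  apply: eq_bigr => j _;
  by rewrite ?(block_mxEul, block_mxEur, block_mxEdl, block_mxEdr).
Qed.

Lemma dot_tr {R : realType} {m n} (A B : 'M[R]_(m, n)) : dot A^T B^T = dot A B.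
Proof.
rewrite /dot exchange_big; apply: eq_bigr => i _; apply: eq_bigr => j _.
by rewrite !mxE.
Qed.

Lemma frob_block_mx_le {R : realType} {m1 m2 n1 n2} (A : 'M[R]_(m1, n1))
    (B : 'M[R]_(m1, n2)) (C : 'M[R]_(m2, n1)) (D : 'M[R]_(m2, n2)) :
  frob (block_mx A B C D) <= frob A + frob B + (frob C + frob D).
Proof.
have [a0 b0 c0 d0] := And4 (frob_ge0 A) (frob_ge0 B) (frob_ge0 C) (frob_ge0 D).
apply: frob_le; first by rewrite !addr_ge0.
rewrite dot_block_mx -!frob_sqr.
have := mulr_ge0 a0 b0; have := mulr_ge0 a0 c0; have := mulr_ge0 a0 d0.
have := mulr_ge0 b0 c0; have := mulr_ge0 b0 d0; have := mulr_ge0 c0 d0.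
lra.
Qed.

(** A function that is quadratic along the line through [y] directed by [v] has
its linear coefficient as directional derivative, by comparison with the same
polynomial of one real variable. *)
Lemma is_derive_quadratic {R : realType} {d} (f : 'cV[R]_d -> R)
    (y v : 'cV[R]_d) (a b : R) :
  (forall h : R, f (y + h *: v) = f y + h * a + h ^+ 2 * b) ->
  is_derive y v f a.
Proof.
move=> fE.
have E : (fun h : R => h^-1 *: ((f \o shift y) (h *: v) - f y))
    = (fun h : R =>
        h^-1 *: (((fun s : R => f y + s * a + s ^+ 2 * b) \o shift 0) (h *: 1)
        - (f y + 0 * a + 0 ^+ 2 * b))).
  apply/funext => h /=; rewrite [_ + y]addrC fE addr0 [h *: 1]mulr1.
  by rewrite expr0n/= !mul0r !addr0.
have [] : is_derive (0 : R) 1 (fun s : R => f y + s * a + s ^+ 2 * b) a.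
  have -> : (fun s : R => f y + s * a + s ^+ 2 * b)
      = cst (f y) + a *: id + b *: (id ^+ 2).
    by apply/funext => s; rewrite /= [s * a]mulrC [_ * b]mulrC.
  apply: (is_derive_eq (is_deriveD (is_deriveD (is_derive_cst _ _ _)
    (is_deriveZ a (is_derive_id _ _)))
    (is_deriveZ b (is_deriveX 2 (is_derive_id _ _))))).
  by rewrite add0r /= mulr0 scale0r scaler0 addr0 [LHS]mulr1.
by move=> d1 d2; split; rewrite /derivable /derive E.
Qed.

Section Gamma.
Context {R : realType} {J N d : nat}.
Variable M : affine_pieces R J N d.
Implicit Types (j : 'I_J) (x y v : 'cV[R]_d).

(** The part of [Gammaj (x + v)] that is linear in [v]. Together with the
quadratic part [ddGamma], it gives the derivative and the curvature of the
pieces at once. *)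
Definition dGamma j x v : 'M[R]_(N + 1) :=
  block_mx ((Abar M j *m v) *m (aj M j x)^T + aj M j x *m (Abar M j *m v)^T)
    (Bbar M j *m v) (Bbar M j *m v)^T (((cbar M j)^T *m v) 0 0)%:M.

Definition ddGamma j v : 'M[R]_(N + 1) :=
  block_mx ((Abar M j *m v) *m (Abar M j *m v)^T) 0 0 0.

Lemma Gammaj_expand j x v (t : R) :
  Gammaj M j (x + t *: v)
  = Gammaj M j x + t *: dGamma j x v + t ^+ 2 *: ddGamma j v.
Proof.
have aE : aj M j (x + t *: v) = aj M j x + t *: (Abar M j *m v).
  by rewrite /aj mulmxDr -scalemxAr addrA.
have bE : bj M j (x + t *: v) = bj M j x + t *: (Bbar M j *m v).
  by rewrite /bj mulmxDr -scalemxAr addrA.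
have cE : cj M j (x + t *: v) = cj M j x + t * ((cbar M j)^T *m v) 0 0.
  by rewrite /cj !mul_tr_dot dotDr dotZr addrA.
rewrite /Gammaj aE bE cE /dGamma /ddGamma !scale_block_mx !add_block_mx.
congr block_mx.
- rewrite linearD/= linearZ/= mulmxDl !mulmxDr -!scalemxAl -!scalemxAr scalerA.
  by rewrite scalerDr expr2 !addrA; congr (_ + _); rewrite addrAC.
- by rewrite scaler0 addr0.
- by rewrite scaler0 addr0 linearD/= linearZ.
- by rewrite scaler0 addr0 raddfD/= scale_scalar_mx.
Qed.

Lemma dGamma_sum j x v :
  dGamma j x v = \sum_i v i 0 *: dGamma j x (delta_mx i 0).
Proof.
have dG0 : dGamma j x 0 = 0.
  rewrite /dGamma mul_tr_dot dot0r !mulmx0 !trmx0 mul0mx !mulmx0 addr0 raddf0.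
  exact: block_mx_const.
have trDZ p q s (A B : 'M[R]_(p, q)) : (s *: A + B)^T = s *: A^T + B^T.
  by apply/matrixP => ? ?; rewrite !mxE.
have dGD s u w : dGamma j x (s *: u + w) = s *: dGamma j x u + dGamma j x w.
  rewrite /dGamma scale_block_mx add_block_mx.
  rewrite !mul_tr_dot dotDr dotZr !mulmxDr -!scalemxAr; congr block_mx.
  - rewrite trDZ mulmxDl mulmxDr -!scalemxAl -!scalemxAr scalerDr.
    by rewrite addrACA.
  - exact: trDZ.
  - by rewrite raddfD/= scale_scalar_mx.
rewrite {1}[v]matrix_sum_delta; under eq_bigr do rewrite big_ord1.
elim/big_rec2 : _ => [|i A w _ <-]; first exact: dG0.
exact: dGD.
Qed.

(** Symmetry of [Z] merges the two off-diagonal blocks into the factor 2. *)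
Lemma Qj_dot j (Z : 'M[R]_(N + 1)) x :
  Z^T = Z -> Qj M j Z x = dot Z (Gammaj M j x).
Proof.
move=> Zsym.
have Zb : Z = block_mx (partY Z) (partz Z) (partz Z)^T (partz0 Z)%:M.
  rewrite -[LHS]submxK; congr block_mx.
    by rewrite /partz trmx_ursub Zsym.
  by apply/matrixP => i k; rewrite /partz0 !ord1 [RHS]mxE eqxx mulr1n.
rewrite [in RHS]Zb /Gammaj dot_block_mx dot_outer dot_tr /Qj -mulmxA.
rewrite !mul_tr_dot.
rewrite (dotC (bj M j x)) [dot _%:M _](_ : _ = cj M j x * partz0 Z).
  by ring.
by rewrite /dot !big_ord1 !mxE !eqxx !mulr1n mulrC.
Qed.

(** Up to the factor [rho], the penalty is a piece [Qj] at the identity matrix.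
*)
Lemma penalty_dot j x :
  ((aj M j x)^T *m aj M j x) 0 0 + cj M j x = dot 1%:M (Gammaj M j x).
Proof.
rewrite (scalar_mx_block N 1 1) /Gammaj dot_block_mx !dot0l dot_outer mul1mx.
by rewrite mul_tr_dot /dot !big_ord1 !mxE !eqxx !mulr1n mul1r addr0 add0r.
Qed.

End Gamma.

(** * Model 2: curvature and mixed Lipschitz bound *)

Lemma is_derive_dot_line {R : realType} {m n} (A B C : 'M[R]_(m, n)) (t : R) :
  is_derive t 1 (fun s : R => dot (A + s *: B) C) (dot B C).
Proof.
have -> : (fun s : R => dot (A + s *: B) C) = cst (dot A C) + dot B C *: id.
  by apply/funext => s; rewrite dotDl dotZl /= [s * _]mulrC.
apply: (is_derive_eq (is_deriveD (is_derive_cst _ _ _)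
  (is_deriveZ (dot B C) (is_derive_id _ _)))).
by rewrite add0r [LHS]mulr1.
Qed.

(** The mean value inequality in the matrix argument. Its derivative has two
parts: the softmax average of [<W - W', G j>], at most [D |W - W'|], and,
divided by [mu], the softmax covariance of [<W - W', C j>] and [<A, G j>],
which [softmax_cov_le] bounds by [J * (k2 |W - W'|) * (k1 D)]. The first part
is enlarged by the factor [J >= 1] to give the stated constant. *)
Lemma softmax_average_diff {R : realType} {J m n} (mu k1 k2 D : R)
    (C G : 'I_J -> 'M[R]_(m, n)) (W W' : 'M[R]_(m, n)) :
  (0 < J)%N -> 0 < mu -> frob W <= k1 -> frob W' <= k1 ->
  (forall j, frob (C j) <= k2) -> (forall j, frob (G j) <= D) ->
  \sum_j softmax mu (fun j => dot W (C j)) j * dot W (G j)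
  - \sum_j softmax mu (fun j => dot W' (C j)) j * dot W' (G j)
  <= J%:R * D * (k1 * k2 / mu + 1) * frob (W - W').
Proof.
move=> J0 mu0 Wk Wk' Ck Gk.
have k10 : 0 <= k1 by apply: le_trans Wk; exact: frob_ge0.
have D0 : 0 <= D by apply: le_trans (Gk (Ordinal J0)); exact: frob_ge0.
have e0 : 0 <= frob (W - W') by exact: frob_ge0.
pose a j := dot (W - W') (C j); pose b j := dot (W - W') (G j).
pose sm A := softmax mu (fun j => dot A (C j)).
apply: (@mean_value_segment _ _ _ [set A | frob A <= k1]
  (fun A => \sum_j sm A j * dot A (G j))
  (fun A => \sum_j (sm A j * b j + dot A (G j)
     * (sm A j * ((a j - \sum_k sm A k * a k) / mu))))).
- move=> s s0 s1 /=.
  have -> : W' + s *: (W - W') = (1 - s) *: W' + s *: W.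
    by apply/matrixP => r c; rewrite !mxE; ring.
  have s1' : 0 <= 1 - s by rewrite subr_ge0.
  apply: le_trans (frobD _ _) _; rewrite !frobZ !ger0_norm//.
  have := ler_wpM2l s0 Wk; have := ler_wpM2l s1' Wk'; lra.
- move=> s _.
  have -> : (fun r => \sum_j sm (W' + r *: (W - W')) j
          * dot (W' + r *: (W - W')) (G j))
     = \sum_j ((fun r => sm (W' + r *: (W - W')) j)
          * (fun r => dot (W' + r *: (W - W')) (G j))).
    by apply/funext => r; rewrite fct_sumE.
  apply: is_derive_sum => j; apply: is_deriveM; last exact: is_derive_dot_line.
  by apply: (is_derive_softmax J0 mu0) => k; exact: is_derive_dot_line.
move=> A /= Ak; set e := frob (W - W') in e0 *.
have ak j : `|a j| <= e * k2.
  by apply: le_trans (normr_dot_le _ _) _; rewrite ler_wpM2l ?frob_ge0.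
have bk j : `|dot A (G j)| <= k1 * D.
  by apply: le_trans (normr_dot_le _ _) _; rewrite ler_pM ?frob_ge0.
have part1 : \sum_j sm A j * b j <= e * D.
  rewrite -[leRHS]mul1r -(softmax_sum1 J0 mu0 (fun j => dot A (C j))) mulr_suml.
  apply: ler_sum => j _; rewrite ler_wpM2l ?(ltW (softmax_gt0 _ _ _))//.
  by apply: le_trans (dot_le _ _) _; rewrite ler_wpM2l ?frob_ge0.
have part2 := softmax_cov_le J0 mu0 (fun j => dot A (C j)) ak bk.
have -> : \sum_j (sm A j * b j + dot A (G j)
     * (sm A j * ((a j - \sum_k sm A k * a k) / mu))) = \sum_j sm A j * b j
   + (\sum_j sm A j * (a j - \sum_k sm A k * a k) * dot A (G j)) / mu.
  rewrite mulr_suml -big_split/=; apply: eq_bigr => j _.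
  by field; rewrite gt_eqF.
have mui : 0 <= mu^-1 by rewrite invr_ge0 ltW.
apply: le_trans (lerD part1 (ler_wpM2r mui part2)) _.
have J1 : 1 <= J%:R :> R by rewrite ler1n.
have := ler_wpM2r (mulr_ge0 e0 D0) J1; rewrite mul1r.
have -> : J%:R * D * (k1 * k2 / mu + 1) * e
  = J%:R * (e * k2 * (k1 * D)) / mu + J%:R * (e * D).
  by field; rewrite gt_eqF.
by rewrite addrC lerD2l.
Qed.

Section GammaAnalysis.
Context {R : realType} {J N d : nat}.
Variable M : affine_pieces R J N d.
Implicit Types (j : 'I_J) (x y v : 'cV[R]_d) (W : 'M[R]_(N + 1)).

Lemma dot_Gammaj_expand W j x v (t : R) : dot W (Gammaj M j (x + t *: v))
  = dot W (Gammaj M j x) + t * dot W (dGamma M j x v)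
    + t ^+ 2 * dot W (ddGamma M j v).
Proof. by rewrite Gammaj_expand !dotDr !dotZr. Qed.

Lemma strongly_subdiff_Gammaj W j (m : R) (X : set 'cV[R]_d) :
  (forall x y, X x -> X y ->
     m / 2 * frob (y - x) ^+ 2 <= dot W (ddGamma M j (y - x))) ->
  strongly_subdiff m X (fun x => dot W (Gammaj M j x)).
Proof.
move=> h x Xx; exists (\col_i dot W (dGamma M j x (delta_mx i 0))) => y Xy.
have -> : y = x + 1 *: (y - x) by rewrite scale1r addrC subrK.
rewrite dot_Gammaj_expand mul1r expr1n mul1r.
have -> : x + 1 *: (y - x) - x = y - x by rewrite scale1r addrAC subrr add0r.
rewrite lerD ?h// lerD2l le_eqVlt; apply/orP; left; apply/eqP.
rewrite [in RHS]dGamma_sum [RHS]dotC dot_suml.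
by apply: eq_bigr => i _; rewrite big_ord1 mxE dotZl mulrC dotC.
Qed.

(** Along a segment the piece is a polynomial of degree 2, and convexity at the
midpoint says that its leading coefficient is nonnegative. Only directions
between points of [Theta] are controlled, since [Theta] may have empty
interior. *)
Lemma convex_Qj_ddGamma_ge0 (Z : 'M[R]_(N + 1)) (Theta : set 'cV[R]_d) j x y :
  Z^T = Z -> convex_function Theta (Qj M j Z) -> Theta x -> Theta y ->
  0 <= dot Z (ddGamma M j (y - x)).
Proof.
move=> Zsym cQ Tx Ty.
have h0 : (0 : R) <= 2^-1 by rewrite invr_ge0.
have h1 : 2^-1 <= (1 : R) by lra.
have := convex_function_segment cQ Tx Ty h0 h1.
have Ey : y = x + 1 *: (y - x) by rewrite scale1r addrC subrK.
have := dot_Gammaj_expand Z j x (y - x) 1.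
rewrite -Ey !Qj_dot// dot_Gammaj_expand.
set P := dot _ _; set L := dot _ _; set Q := dot _ _; set E := dot _ _.
move=> ->; lra.
Qed.

Lemma dGammajE i j x : dGammaj M i j x = dGamma M j x (delta_mx i 0).
Proof.
apply/matrixP => r c; rewrite mxE /pderiv.
have [] // : is_derive x (delta_mx i 0) (fun th => Gammaj M j th r c)
  (dGamma M j x (delta_mx i 0) r c).
by apply: (is_derive_quadratic (b := ddGamma M j (delta_mx i 0) r c)) => h;
  rewrite Gammaj_expand !mxE.
Qed.

(** Each coordinate of [v] is bounded by its norm, whence the factor [d]. *)
Lemma frob_dGamma_le j x v (k : R) :
  (forall i, frob (dGammaj M i j x) <= k) ->
  frob (dGamma M j x v) <= d%:R * k * frob v.
Proof.
move=> hk; rewrite dGamma_sum.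
apply: le_trans (frob_sum_le _ _ _) _.
have -> : d%:R * k * frob v = \sum_(i < d) frob v * k.
  by rewrite sumr_const card_ord -mulr_natl; ring.
apply: ler_sum => i _; rewrite frobZ -dGammajE ler_pM ?frob_ge0//.
exact: coord_le_frob.
Qed.

Lemma is_derive_dot_Gammaj W j x v (t : R) :
  is_derive t 1 (fun s : R => dot W (Gammaj M j (x + s *: v)))
    (dot W (dGamma M j (x + t *: v) v)).
Proof.
have [d1 <-] := is_derive_quadratic
  (f := fun th => dot W (Gammaj M j th)) (dot_Gammaj_expand W j (x + t *: v) v).
exact: is_derive_line.
Qed.

(** The mean value inequality in the decision: the derivative in the direction
[v - u] is the difference of the softmax averages at [W] and [W'] to which
[softmax_average_diff] applies. *)
Lemma lse_Gammaj_diff (mu k1 k2 k3 : R) (Theta : set 'cV[R]_d) W W' u v :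
  (0 < J)%N -> 0 < mu -> convex_set Theta ->
  frob W <= k1 -> frob W' <= k1 ->
  (forall x j, Theta x -> frob (Gammaj M j x) <= k2) ->
  (forall x i j, Theta x -> frob (dGammaj M i j x) <= k3) ->
  Theta u -> Theta v ->
  (lse mu (fun j => dot W (Gammaj M j v))
   - lse mu (fun j => dot W (Gammaj M j u)))
  - (lse mu (fun j => dot W' (Gammaj M j v))
     - lse mu (fun j => dot W' (Gammaj M j u)))
  <= J%:R * d%:R * k3 * (k1 * k2 / mu + 1) * frob (u - v) * frob (W - W').
Proof.
move=> J0 mu0 cT Wk Wk' Gk dGk Tu Tv.
have -> (a b c e : R) : a - b - (c - e) = (a - c) - (b - e) by ring.
apply: (@mean_value_segment _ _ _ Theta
  (fun x => lse mu (fun j => dot W (Gammaj M j x))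
     - lse mu (fun j => dot W' (Gammaj M j x)))
  (fun x => \sum_j softmax mu (fun j => dot W (Gammaj M j x)) j
       * dot W (dGamma M j x (v - u))
     - \sum_j softmax mu (fun j => dot W' (Gammaj M j x)) j
       * dot W' (dGamma M j x (v - u)))).
- by move=> t; exact: convex_set_segment.
- move=> t _; apply: is_deriveB; apply: (is_derive_lse J0 mu0) => j;
    exact: is_derive_dot_Gammaj.
move=> x Tx.
have Gx j : frob (dGamma M j x (v - u)) <= d%:R * k3 * frob (v - u).
  by apply: frob_dGamma_le => i; exact: dGk.
apply: le_trans (softmax_average_diff J0 mu0 Wk Wk' (fun j => Gk x j Tx) Gx) _.
by rewrite le_eqVlt (frobBC u); apply/orP; left; apply/eqP; ring.
Qed.

End GammaAnalysis.

(** * Model 2: contraction *)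

Lemma bounded_set_frob {R : realType} {m n} (A : set 'M[R]_(m, n)) :
  bounded_set A -> exists k, forall x, A x -> frob x <= k.
Proof.
move=> [k [_ Ak]]; exists ((m * n)%:R * (k + 1)) => x Ax.
apply: le_trans (frob_le_mx_norm x) _; rewrite ler_wpM2l//.
by apply: Ak Ax; rewrite ltrDl.
Qed.

Section Model2.
Context {R : realType} {d S J N : nat}.
Variables (Theta : set 'cV[R]_d) (eps rho : R) (M : affine_pieces R J N d)
  (Z : set 'M[R]_(N + 1)) (Phat : 'cV[R]_d -> refdist R S 'M[R]_(N + 1))
  (mu : R).
Hypotheses (Theta0 : Theta !=set0) (clTheta : closed Theta)
  (cTheta : convex_set Theta).
Hypotheses (eps0 : 0 <= eps) (rho0 : 0 < rho) (J0 : (0 < J)%N) (mu0 : 0 < mu).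
Hypotheses (Zsym : forall z, Z z -> z^T = z) (sP : supported_in Theta Phat Z).
Hypotheses (cQ : forall j, convex_loss Theta Z (Qj M j)).
Hypotheses (pd : forall j, posdef ((Abar M j)^T *m Abar M j)).
Hypotheses (bTheta : bounded_set Theta)
  (bsupp : bounded_set (\bigcup_(theta in Theta) supp (Phat theta))).
Hypothesis sens : sensitive Theta Phat eps.

(** [Gammaj] is quadratic and its partial derivatives are affine in the
decision, which ranges over a bounded set; summing over [j] makes the bounds
uniform in the piece. *)
Lemma model2_bounds_exist :
  exists k1 k2 k3, model2_bounds M Theta Phat k1 k2 k3.
Proof.
have [T Tb] := bounded_set_frob bTheta; have [k1 k1b] := bounded_set_frob bsupp.
have T0 : 0 <= T.
  by have [x Tx] := Theta0; apply: le_trans (Tb x Tx); exact: frob_ge0.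
have affine_le (a : 'cV[R]_N) (A : 'M[R]_(N, d)) x : Theta x ->
    frob (a + A *m x) <= frob a + frob A * T.
  move=> Tx; apply: le_trans (frobD _ _) _; rewrite lerD2l.
  by apply: le_trans (frob_mulmx _ _) _; rewrite ler_wpM2l ?frob_ge0// Tb.
have outer_le (x y : 'cV[R]_N) (p q : R) : frob x <= p -> frob y <= q ->
    frob (x *m y^T) <= p * q.
  move=> xp yq; apply: le_trans (frob_mulmx _ _) _.
  by rewrite frob_trmx ler_pM ?frob_ge0.
have scal_le (s : R) : frob (s%:M : 'M[R]_1) <= `|s|.
  apply: le_trans (frob_le_sum _) _; rewrite !big_ord1 mxE eqxx mulr1n//.
have sum_le (F : 'I_J -> R) j : (forall i, 0 <= F i) -> F j <= \sum_i F i.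
  by move=> F0; rewrite (bigD1 j)//= lerDl; apply: sumr_ge0.
pose ca j := frob (abar M j) + frob (Abar M j) * T.
pose cb j := frob (bbar M j) + frob (Bbar M j) * T.
pose cc j := `|c0bar M j| + frob (cbar M j) * T.
pose F j := ca j * ca j + cb j + (cb j + cc j).
pose G j := frob (Abar M j) * ca j + ca j * frob (Abar M j) + frob (Bbar M j)
  + (frob (Bbar M j) + frob (cbar M j)).
have ca0 j : 0 <= ca j by rewrite addr_ge0 ?mulr_ge0 ?frob_ge0.
have cb0 j : 0 <= cb j by rewrite addr_ge0 ?mulr_ge0 ?frob_ge0.
have cc0 j : 0 <= cc j by rewrite addr_ge0 ?mulr_ge0 ?frob_ge0.
have delta1 i : frob (delta_mx i 0 : 'cV[R]_d) <= 1.
  apply: frob_le => //.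
  rewrite /dot (bigD1 i)//= big_ord1 mxE !eqxx mulr1 expr1n.
  rewrite big1 ?addr0// => l li.
  by rewrite big_ord1 mxE (negPf li) mul0r.
exists k1, (\sum_j F j), (\sum_j G j); split.
- by move=> x z Tx sz; apply: k1b; exists x.
- move=> x j Tx; apply: le_trans (sum_le F j _); last first.
    by move=> i; rewrite /F; do !apply: addr_ge0 => //; exact: mulr_ge0.
  apply: le_trans (frob_block_mx_le _ _ _ _) _; rewrite frob_trmx.
  have bjb := affine_le (bbar M j) (Bbar M j) x Tx.
  apply: lerD; [apply: lerD => //|apply: lerD => //].
    by apply: outer_le; exact: affine_le.
  apply: le_trans (scal_le _) _; apply: le_trans (ler_normD _ _) _.
  rewrite lerD2l mul_tr_dot; apply: le_trans (normr_dot_le _ _) _.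
  by rewrite ler_wpM2l ?frob_ge0// Tb.
- move=> x i j Tx; apply: le_trans (sum_le G j _); last first.
    move=> l; rewrite /G; do !apply: addr_ge0; rewrite ?frob_ge0//;
      by apply: mulr_ge0; rewrite ?frob_ge0.
  have mul_delta p (A : 'M[R]_(p, d)) :
      frob (A *m (delta_mx i 0 : 'cV[R]_d)) <= frob A.
    apply: le_trans (frob_mulmx _ _) _. by rewrite ler_piMr ?frob_ge0 ?delta1.
  rewrite dGammajE; apply: le_trans (frob_block_mx_le _ _ _ _) _.
  rewrite frob_trmx; apply: lerD; apply: lerD => //.
    apply: le_trans (frobD _ _) _.
    by apply: lerD; apply: outer_le => //; exact: affine_le.
  apply: le_trans (scal_le _) _; rewrite mul_tr_dot.
  by apply: le_trans (normr_dot_le _ _) _; rewrite ler_piMr ?frob_ge0 ?delta1.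
Qed.

Let pen j x := rho * dot 1%:M (Gammaj M j x).

Let J2E (P : refdist R S 'M[R]_(N + 1)) x : J2 M mu rho P x =
  \sum_s prob P s * lse mu (fun j => Qj M j (atom P s) x)
  + lse mu (fun j => pen j x).
Proof.
rewrite /J2 mulr_sumr; congr (_ + _).
  by apply: eq_bigr => s _; rewrite mulrCA.
rewrite /lse; congr (_ * ln _); apply: eq_bigr => j _.
by rewrite penalty_dot.
Qed.

(** The expectation is convex because every piece is; all of the curvature
comes from the penalty, whose pieces have the second-order part [rho |Abar
v|^2]. *)
Lemma J2_strongly_subdiff (c : R) x : Theta x ->
  (forall j (v : 'cV[R]_d),
     c / 2 * frob v ^+ 2 <= rho * frob (Abar M j *m v) ^+ 2) ->
  strongly_subdiff c Theta (J2 M mu rho (Phat x)).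
Proof.
move=> Tx hc; have -> : J2 M mu rho (Phat x) = fun y =>
    \sum_s prob (Phat x) s * lse mu (fun j => Qj M j (atom (Phat x) s) y)
    + lse mu (fun j => pen j y).
  by apply/funext => y; exact: J2E.
apply: strongly_subdiffD (esym (add0r c)) _ _.
  apply: strongly_subdiff_sum; [exact: prob_ge0|exact: prob_sum1|] => s ps.
  have Zs : Z (atom (Phat x) s) by apply: (sP Tx); exact: supp_prob_gt0.
  apply: strongly_subdiff_lse => // j.
  have -> : Qj M j (atom (Phat x) s)
      = fun y => dot (atom (Phat x) s) (Gammaj M j y).
    by apply/funext => y; rewrite Qj_dot// Zsym.
  apply: strongly_subdiff_Gammaj => y z Ty Tz; rewrite !mul0r.
  by apply: convex_Qj_ddGamma_ge0 (Zsym Zs) _ Ty Tz; exact: cQ.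
apply: strongly_subdiff_lse => // j.
have -> : pen j = fun y => dot (rho *: 1%:M) (Gammaj M j y).
  by apply/funext => y; rewrite dotZl.
apply: strongly_subdiff_Gammaj => y z _ _; apply: le_trans (hc j _) _.
rewrite dotZl ler_wpM2l ?(ltW rho0)// (scalar_mx_block N 1 1) dot_block_mx.
by rewrite !dot0r !addr0 dot_outer mul1mx frob_sqr.
Qed.

Lemma model2_contraction k1 k2 k3 : model2_bounds M Theta Phat k1 k2 k3 ->
  let k := eps * ((J%:R * d%:R * k3 * (k1 * k2 / mu + 1)) / (rho * alpha2 M)) in
  step_lipschitz Theta (next2 M Theta mu rho Phat) k /\
  (k < 1 -> converges_to_unique_stable Theta (next2 M Theta mu rho Phat) k).
Proof.
move=> [k1b k2b k3b] k.
have [x0 Tx0] := Theta0.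
have [s ps] : exists s, 0 < prob (Phat x0) s.
  apply: contrapT => /forallNP h; have := prob_sum1 (Phat x0).
  rewrite big1 => [/esym/eqP|s _]; first by rewrite oner_eq0.
  by apply/eqP; rewrite eq_le prob_ge0 andbT leNgt; apply/negP; exact: h.
have k10 : 0 <= k1.
  by apply: le_trans (k1b _ _ Tx0 (supp_prob_gt0 ps)); exact: frob_ge0.
have k20 : 0 <= k2.
  by apply: le_trans (k2b x0 (Ordinal J0) Tx0); exact: frob_ge0.
have K0 : 0 <= J%:R * d%:R * k3 * (k1 * k2 / mu + 1).
  apply: mulr_ge0; last first.
    by rewrite addr_ge0// divr_ge0 ?(ltW mu0)// mulr_ge0.
  have [->|d0] := posnP d; first by rewrite mulr0 mul0r.
  rewrite mulr_ge0// (le_trans _ (k3b x0 (Ordinal d0) (Ordinal J0) Tx0))//.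
  exact: frob_ge0.
have [d0|d0] := posnP d.
  (* then [alpha2] may vanish, but all points coincide and [k = 0] *)
  have eq0 (x y : 'cV[R]_d) : x = y.
    by apply/matrixP => i; have := ltn_ord i; rewrite {2}d0.
  have kE : k = 0 by rewrite /k (_ : d%:R = 0 :> R) ?d0// mulr0 !mul0r mulr0.
  have step : step_lipschitz Theta (next2 M Theta mu rho Phat) k.
    by move=> x y u v _ _ _ _; rewrite (eq0 u v) subrr frob0 kE mul0r.
  split=> // k1'; apply: contraction_converges_to_unique_stable => //.
  + by move=> x Tx; exists x; split=> // y _; rewrite (eq0 y x).
  + by move=> x u _ [].
  + by rewrite kE.
have [alpha0 alphaP] := alpha2P J0 d0 pd.
have c0 : 0 < rho * alpha2 M by rewrite mulr_gt0.
have sJ x : Theta x ->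
    strongly_subdiff (rho * alpha2 M) Theta (J2 M mu rho (Phat x)).
  move=> Tx; apply: J2_strongly_subdiff => // j v.
  by rewrite -2!mulrA ler_wpM2l ?(ltW rho0)// mulrA.
have step : step_lipschitz Theta (next2 M Theta mu rho Phat) k.
  apply: (step_lipschitz_argmin c0 K0 sens) => x y u v Tx Ty xu yv.
  apply: (argmin_dist_le_W1
    (phi := fun z t => lse mu (fun j => Qj M j z t)) cTheta K0 (J2E _) (J2E _)
    (sJ x Tx) (sJ y Ty) xu yv).
  move=> z z' sz sz'.
  have QE w t : Z w ->
      lse mu (fun j => Qj M j w t) = lse mu (fun j => dot w (Gammaj M j t)).
    by move=> Zw; congr lse; apply/funext => j; rewrite Qj_dot// Zsym.
  rewrite /= !QE; try exact: (sP Ty sz'); try exact: (sP Tx sz).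
  apply: (lse_Gammaj_diff J0 mu0 cTheta (k1b _ _ Tx sz) (k1b _ _ Ty sz')
    _ _ xu.1 yv.1) => //.
split=> // k1'; apply: contraction_converges_to_unique_stable => //.
- by move=> x Tx; apply: minimizer_exists c0 (sJ x Tx).
- by move=> x u _ [].
- by rewrite mulr_ge0// divr_ge0// ltW.
Qed.

End Model2.

Theorem theorem1 (R : realType) (d S : nat) (Theta : set 'cV[R]_d)
    (eps rho : R) :
  Theta !=set0 -> closed Theta -> convex_set Theta ->
  0 <= eps -> 0 < rho ->
  [/\ (* Model 1 *)
      forall (Z : set 'M[R]_(d + 1))
             (Phat : 'cV[R]_d -> refdist R S 'M[R]_(d + 1))
             (Lfun : R -> R) (L gamma beta : R),
        let kappa := beta / (gamma + 2 * rho * L) in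
        (forall z, Z z -> z^T = z) ->
        supported_in Theta Phat Z ->
        L.-lipschitz Lfun ->
        0 <= gamma -> 0 < gamma + 2 * rho * L -> 0 <= beta ->
        convex_loss Theta Z (loss1 Lfun) ->
        differentiable_loss Theta Z (loss1 Lfun) ->
        strongly_convex Theta Z (loss1 Lfun) gamma ->
        smooth Theta Z (loss1 Lfun) beta ->
        sensitive Theta Phat eps ->
        step_lipschitz Theta (next1 Theta Lfun L rho Phat) (eps * kappa) /\
        (eps * kappa < 1 ->
         converges_to_unique_stable Theta (next1 Theta Lfun L rho Phat)
           (eps * kappa)),
      (* Model 2 *)
      forall (J N : nat) (M : affine_pieces R J N d)
             (Z : set 'M[R]_(N + 1))
             (Phat : 'cV[R]_d -> refdist R S 'M[R]_(N + 1)) (mu : R),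
        (0 < J)%N -> 0 < mu ->
        (forall z, Z z -> z^T = z) ->
        supported_in Theta Phat Z ->
        convex_loss Theta Z (loss2 M) ->
        (forall j, convex_loss Theta Z (Qj M j)) ->
        (forall j, posdef ((Abar M j)^T *m Abar M j)) ->
        bounded_set Theta ->
        bounded_set (\bigcup_(theta in Theta) supp (Phat theta)) ->
        sensitive Theta Phat eps ->
        (exists k1 k2 k3, model2_bounds M Theta Phat k1 k2 k3) /\
        forall k1 k2 k3, model2_bounds M Theta Phat k1 k2 k3 ->
        let kappa := (J%:R * d%:R * k3 * (k1 * k2 / mu + 1))
                     / (rho * alpha2 M) in
        step_lipschitz Theta (next2 M Theta mu rho Phat) (eps * kappa) /\
        (eps * kappa < 1 ->
         converges_to_unique_stable Theta (next2 M Theta mu rho Phat)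
           (eps * kappa)) &
      (* Model 3 *)
      forall (m : nat) (Z : set 'cV[R]_m)
             (Phat : 'cV[R]_d -> refdist R S 'cV[R]_m)
             (loss : 'cV[R]_m -> 'cV[R]_d -> R) (tau gamma beta : R),
        let kappa := (beta + 4 * diam Z) / Num.min (2 * tau) gamma in
        0 < tau -> 0 < gamma -> 0 <= beta ->
        Z !=set0 -> convex_set Z -> closed Z ->
        supported_in Theta Phat Z ->
        usc_loss Z loss Theta ->
        concave_loss Z loss Theta ->
        has_ubound (distances Z) ->
        convex_loss Theta Z loss ->
        differentiable_loss Theta Z loss ->
        strongly_convex Theta Z loss gamma ->
        smooth Theta Z loss beta ->
        sensitive Theta Phat eps ->
        step_lipschitz Theta (next3 Z loss Theta rho tau Phat) (eps * kappa) /\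
        (eps * kappa < 1 ->
         converges_to_unique_stable Theta (next3 Z loss Theta rho tau Phat)
           (eps * kappa))].
Proof.
move=> Theta0 clTheta cTheta eps0 rho0; split.
- move=> Z Phat Lfun L gamma beta kappa _ sP _ _ c0 beta0 _ dl sc sl sens.
  exact: (model1_contraction Theta0 clTheta cTheta eps0 sP c0 beta0 dl sc sl
    sens).
- move=> J N M Z Phat mu J0 mu0 Zsym sP _ cQ pd bTheta bsupp sens; split.
    exact: (model2_bounds_exist M Theta0 bTheta bsupp).
  move=> k1 k2 k3 bounds kappa.
  exact: (model2_contraction Theta0 clTheta cTheta eps0 rho0 J0 mu0 Zsym sP cQ
    pd sens bounds).
- move=> m Z Phat loss tau gamma beta kappa tau0 gamma0 beta0 Z0 cZ clZ sP usc
    conc Zdiam _ dl sc sl sens.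
  exact: (model3_contraction rho Theta0 clTheta cTheta eps0 tau0 gamma0 beta0 Z0
    cZ clZ Zdiam sP usc conc dl sc sl sens).
Qed.
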